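(* Let $K\subseteq I$ with $0,5\in K$ and $1,2,3,4\in I\setminus K$. Let $(X_i,Y_i)$, $i=1,2,3$, be the homogeneous coordinates of the linear factors of the cubic form $$r=(01)(02)(03)-(04)(05)^2,$$ i.e. $r=C\prod_{i=1}^3(xY_i-yX_i-hyY_i)$, and let $de_{X_i,Y_i}=(w^{(i)})^{-1}(dX_i,X_i)$ with $w^{(i)}=\sqrt{(X_i1)(X_i2)(X_i3)(X_i4)}$ be the associated elliptic differentials of the first kind. Then $$\epsilon_1\,de_{X_1,Y_1}+\epsilon_2\,de_{X_2,Y_2}+\epsilon_3\,de_{X_3,Y_3}=0$$ with certain $\epsilon_i=\pm1$.
   Context: Fix $h\in\mathbb C$, $h\neq0$. $U_h(sl(2))$ is the complex unital Hopf algebra with generators $E,F,H$, relations $[H,E]=E\cosh(hF)+\cosh(hF)E$, $[H,F]=-\frac2h\sinh(hF)$, $[E,F]=H$, and coproduct $\Delta(E)=E\otimes e^{-hF}+e^{hF}\otimes E$, $\Delta(F)=F\otimes1+1\otimes F$, $\Delta(H)=H\otimes e^{-hF}+e^{hF}\otimes H$. For a totally ordered index set $I$, $H_I$ is the unital complex algebra with generators $x_i,y_i$ ($i\in I$) and relations $x_iy_i=y_ix_i+hy_i^2$ and, for $i<j$, $x_jy_i=y_ix_j+hy_iy_j$, $y_jx_i=x_iy_j-hy_iy_j$, $y_jy_i=y_iy_j$, $x_jx_i=x_ix_j-hx_iy_j+hy_ix_j+h^2y_iy_j$. It is a $U_h(sl(2))$-module algebra via $Hx_i=x_i$, $Hy_i=-y_i$,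 $Ex_i=0$, $Ey_i=x_i$, $Fx_i=y_i$, $Fy_i=0$, $E1=F1=H1=0$ and the Leibniz rules given by the coproduct. $H_I$ is a domain with right quotient division ring $Q_I$, to which the action extends. Invariant elements $v$ are those with $Ev=Fv=Hv=0$ (superscript $Inv$). The brackets $(ij)=x_iy_j-y_ix_j-hy_iy_j$ are invariant and central in $H_I$. $H_J$, $Q_J$ denote the subalgebras belonging to $J\subseteq I$. Let $0\in I$, $x=x_0$, $y=y_0$. Decomposition of forms. An $n$-form is a nonzero invariant element $f=\sum_i x^{n-i}y^iA_i$ with $A_i\in H_{I\setminus\{0\}}$. Let $a\in I$ be an auxiliary index ($a\ne0$) whose variables do not occur in $f$. Let $\Delta_{kl}$ be the derivation of $H_I$ with $x_k\mapsto x_l$, $y_k\mapsto y_l$, all other generators $\mapsto0$, and $P_{kl}=\frac1m\Delta_{kl}$ on elements homogeneous of degree $m$ in the index $k$. Put $f_a=P_{0a}^nf$, $\xi=P_{0a}^{n-1}f=x\delta-y\gamma-hy\delta$ with $\gamma,\delta\in H_{I\setminus\{0\}}$, $\eta=(0a)$. There are invariant $u_i\in H_{I\setminus\{0\}}$ with $f=f_a^{-n}\sum_i\xi^{n-i}\eta^iu_i$; in a commutative splitting field $\Sigma\supset Q^{Inv}_{I\setminus\{0\}}$ one writes $f=C\prod_i(\xi-\sigma_i\eta)$ with $C=f_a^{1-n}\in Q^{Inv}_{I\setminus\{0\}}$. The $\sigma_i$ are taken to be invariant and to commute with $Q_I$ and each other, and $Q_I^\Sigma=Q_I[\sigma_1,\dots,\sigma_n]$,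 $Q^\Sigma_{I\setminus\{0\}}=Q_{I\setminus\{0\}}[\sigma_1,\dots,\sigma_n]$ are the central skew field extensions. Then $f=C\prod_{i=1}^n(xY_i-yX_i-hyY_i)$ with $X_i=\gamma-\sigma_ix_a$, $Y_i=\delta-\sigma_iy_a\in Q^\Sigma_{I\setminus\{0\}}$; $(X_i,Y_i)$ are called the homogeneous coordinates of the linear factors of $f$, and $Z_i=X_iY_i^{-1}+\frac h2$. In the claim this is applied to $f=r$, $n=3$. Notation: $(X_ij):=X_iy_j-Y_ix_j-hY_iy_j$ for $j\in I$. $Q_I^{\Sigma,w}$ is the skew field obtained from $Q_I^\Sigma$ by adjoining central root elements $w^{(i)}$ with $(w^{(i)})^2=(X_i1)(X_i2)(X_i3)(X_i4)$, $i=1,2,3$. Differentials. $\Gamma_{I,K}=Q_Id_KQ_I$ is the $Q_I$-bimodule generated by symbols $dx_j,dy_j$ ($j\in K$) with relations, for $i\in I$, $j\in K$, $dx_j\cdot x_i=x_idx_j-hx_idy_j+hy_idx_j+h^2y_idy_j$, $dy_j\cdot y_i=y_idy_j$, $dx_j\cdot y_i=y_idx_j+hy_idy_j$, $dy_j\cdot x_i=x_idy_j-hy_idy_j$. The total differential $d=d_K:Q_I\to\Gamma_{I,K}$ is the linear map with $d(x_i)=dx_i$, $d(y_i)=dy_i$ for $i\in K$, $d(x_i)=d(y_i)=0$ for $i\in I\setminus K$, and $d(ab)=da\cdot b+a\,db$. For a central extension $S=Q_I[\sigma_1,\dots]$ the differential module $Sd_KS$ is defined analogously, with the additional requirements given by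 the (differentiated) defining relations of the adjoined elements $\sigma$ and the conditions $\sigma\,dt-dt\cdot\sigma=0$ and $t\,d\sigma-d\sigma\cdot t=0$ for $t\in S$. The claimed identity holds in the differential module $Q_I^{\Sigma,w}d_KQ_I^{\Sigma,w}$. Finally $(dX_i,X_i):=dX_i\cdot Y_i-dY_i\cdot X_i-h\,dY_i\cdot Y_i=Y_i^2\,dZ_i$. *)

(* Defs.v *)
From HB Require Import structures.
From mathcomp Require Import all_boot all_order all_algebra.
From mathcomp Require Import boolp classical_sets reals.
From mathcomp Require Export complex.

Set Implicit Arguments.
Unset Strict Implicit.
Unset Printing Implicit Defensive.

Import Order.TTheory GRing.Theory Num.Theory.

Local Open Scope classical_set_scope.
Local Open Scope ring_scope.

Definition subalgebra (C : fieldType) (A : algType C) (B : set A) : Prop :=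
  [/\ B 1,
      forall (c : C) a b, B a -> B b -> B (c *: a + b)
    & forall a b, B a -> B b -> B (a * b)].

Definition skew_subfield (D : unitRingType) (B : set D) : Prop :=
  [/\ B 1,
      forall a b, B a -> B b -> B (a - b),
      forall a b, B a -> B b -> B (a * b)
    & forall a, B a -> B a^-1].

Definition division_ring (D : unitRingType) : Prop :=
  forall a : D, a != 0 -> a \is a GRing.unit.

(* The subalgebra belonging to the index set J. *)
Definition alg_of (C : fieldType) (A : algType C) (I : Type) (x y : I -> A)
    (J : set I) : set A :=
  smallest (@subalgebra C A) ((x @` J) `|` (y @` J)).

(* The bracket of two coordinate pairs: (ij) is [bracket h x_i y_i x_j y_j],
   (X j) is [bracket h X Y x_j y_j], and x Y - y X - h y Y is
   [bracket h x y X Y]. *)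
Definition bracket (C : fieldType) (A : algType C) (h : C) (x y x' y' : A) : A :=
  x * y' - y * x' - h *: (y * y').

(** * The algebra H_I *)

Definition H_relations (C : fieldType) (h : C) (disp : Order.disp_t)
    (I : orderType disp) (A : algType C) (x y : I -> A) : Prop :=
  (forall i, x i * y i = y i * x i + h *: (y i ^+ 2)) /\
  (forall i j, (i < j)%O ->
     [/\ x j * y i = y i * x j + h *: (y i * y j),
         y j * x i = x i * y j - h *: (y i * y j),
         y j * y i = y i * y j
       & x j * x i = x i * x j - h *: (x i * y j) + h *: (y i * x j)
                     + h ^+ 2 *: (y i * y j)]).

(* H is the unital algebra presented by the generators x_i, y_i and the above
   relations (a morphism out of H is unique because of [H_gen]). *)
Record presented_H (C : fieldType) (h : C) (disp : Order.disp_t)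
    (I : orderType disp) (H : algType C) (x y : I -> H) : Prop := {
  H_rel : H_relations h x y;
  H_gen : alg_of x y setT = setT;
  H_univ : forall (A : algType C) (x' y' : I -> A), H_relations h x' y' ->
    exists f : {lrmorphism H -> A}, forall i, f (x i) = x' i /\ f (y i) = y' i
}.

(** * Quotient division rings and central skew field extensions *)

Definition fractions (C : fieldType) (H : algType C) (Q : unitAlgType C)
    (iota : {lrmorphism H -> Q}) (B : set H) : set Q :=
  [set q | exists a b, [/\ B a, B b, b != 0 & q = iota a / iota b]].

Record right_quotient_division_ring (C : fieldType) (H : algType C)
    (Q : unitAlgType C) (iota : {lrmorphism H -> Q}) : Prop := {
  quot_div : division_ring Q;
  quot_inj : injective iota;
  quot_frac : fractions iota setT = setT
}.

(* B is a skew field, generated over A by the set G of central elements. *)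
Record central_extension (C : fieldType) (A B : unitAlgType C)
    (j : {lrmorphism A -> B}) (G : set B) : Prop := {
  cext_div : division_ring B;
  cext_central : forall g, G g -> forall b, g * b = b * g;
  cext_gen : smallest (@subalgebra C B) (range j `|` G) = setT
}.

(** * U_h(sl(2))-module algebras *)

(* [expF] and [expFV] are the actions of the group-like elements e^{hF} and
   e^{-hF}; they are given by the exponential series wherever F acts locally
   nilpotently (as on H_I), and are extended as algebra automorphisms (as on
   the quotient division ring).  cosh(hF) and sinh(hF) act as
   (e^{hF} + e^{-hF})/2 and (e^{hF} - e^{-hF})/2. *)
Record Uh_module_algebra (C : fieldType) (h : C) (A : algType C) := {
  actE : {linear A -> A};
  actF : {linear A -> A};
  actH : {linear A -> A};
  expF : {lrmorphism A -> A};
  expFV : {lrmorphism A -> A};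
  expF_series : forall n a, iter n actF a = 0 ->
    expF a = \sum_(k < n) (h ^+ k / (k`!)%:R) *: iter k actF a;
  expFV_series : forall n a, iter n actF a = 0 ->
    expFV a = \sum_(k < n) ((- h) ^+ k / (k`!)%:R) *: iter k actF a;
  expFK : cancel expF expFV;
  expFVK : cancel expFV expF;
  expF_actF : forall a, expF (actF a) = actF (expF a);
  Uh_HE : forall a, actH (actE a) - actE (actH a) =
    actE (2%:R^-1 *: (expF a + expFV a))
    + 2%:R^-1 *: (expF (actE a) + expFV (actE a));
  Uh_HF : forall a, actH (actF a) - actF (actH a) =
    - (2%:R / h) *: (2%:R^-1 *: (expF a - expFV a));
  Uh_EF : forall a, actE (actF a) - actF (actE a) = actH a;
  actE1 : actE 1 = 0;
  actF1 : actF 1 = 0;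
  actH1 : actH 1 = 0;
  actEM : forall a b, actE (a * b) = actE a * expFV b + expF a * actE b;
  actFM : forall a b, actF (a * b) = actF a * b + a * actF b;
  actHM : forall a b, actH (a * b) = actH a * expFV b + expF a * actH b
}.

Definition action_on_generators (C : fieldType) (h : C) (A : algType C)
    (U : Uh_module_algebra h A) (I : Type) (x y : I -> A) : Prop :=
  forall i,
    [/\ actH U (x i) = x i /\ actH U (y i) = - y i,
        actE U (x i) = 0 /\ actE U (y i) = x i
      & actF U (x i) = y i /\ actF U (y i) = 0].

Definition invariant (C : fieldType) (h : C) (A : algType C)
    (U : Uh_module_algebra h A) (v : A) : Prop :=
  [/\ actE U v = 0, actF U v = 0 & actH U v = 0].

(** * Decomposition of forms *)

Definition is_Delta (C : fieldType) (A : algType C) (I : eqType)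
    (x y : I -> A) (k l : I) (D : A -> A) : Prop :=
  [/\ forall (c : C) a b, D (c *: a + b) = c *: D a + D b,
      forall a b, D (a * b) = D a * b + a * D b,
      D (x k) = x l /\ D (y k) = y l
    & forall i, i != k -> D (x i) = 0 /\ D (y i) = 0].

(* P_{kl}^m f for f homogeneous of degree n in the index k, D = Delta_{kl}:
   as D lowers the degree by one, the successive steps are
   D/n, D/(n-1), ..., D/(n-m+1). *)
Fixpoint polarization (C : fieldType) (A : algType C) (D : A -> A) (n m : nat)
    (f : A) : A :=
  if m is m'.+1
  then ((n - m')%N%:R : C)^-1 *: D (polarization D n m' f) else f.

(* The coordinates X = gamma - sigma x_a and Y = delta - sigma y_a are both of
   the shape [factor_coord gamma sigma x_a], resp. with delta and y_a. *)
Definition factor_coord (C : fieldType) (A : algType C) (g s t : A) : A :=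
  g - s * t.

(* Q^Inv_J, as a subset of an extension S of Q carrying the action. *)
Definition invariant_fractions (C : fieldType) (h : C) (H : algType C)
    (Q : unitAlgType C) (iota : {lrmorphism H -> Q}) (S : unitAlgType C)
    (j : {lrmorphism Q -> S}) (U : Uh_module_algebra h S) (B : set H) : set S :=
  [set s | (j @` fractions iota B) s /\ invariant U s].

(* The data (gamma, delta, sigma) decompose the n-form f into linear factors,
   with main index o, auxiliary index a, D = Delta_{oa},
   f_a = P_{oa}^n f, xi = P_{oa}^{n-1} f, eta = (oa). *)
Record form_decomposition (C : fieldType) (h : C) (I : eqType)
    (H : algType C) (x y : I -> H) (Q : unitAlgType C)
    (iota : {lrmorphism H -> Q}) (S : unitAlgType C) (j : {lrmorphism Q -> S})
    (U : Uh_module_algebra h S) (o a : I) (D : H -> H) (n : nat) (f : H)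
    (gamma delta : H) (sigma : 'I_n -> S) : Prop := {
  dec_aux : a != o /\ alg_of x y [set i | i != a] f;
  dec_Delta : is_Delta x y o a D;
  dec_gamma : alg_of x y [set i | i != o] gamma;
  dec_delta : alg_of x y [set i | i != o] delta;
  dec_xi : polarization D n n.-1 f = bracket h (x o) (y o) gamma delta;
  (* The splitting field Sigma is generated by Q^Inv_{I \ {o}} and the roots
     sigma_i; the split polynomial is sum_i u_i T^(n-i), whose leading
     coefficient is u_0 = f_a. *)
  dec_Sigma : forall s t : S,
    let Sigma := smallest (@skew_subfield S)
      (invariant_fractions iota j U (alg_of x y [set i | i != o])
       `|` range sigma) in
    Sigma s -> Sigma t -> s * t = t * s;
  dec_sigma_inv : forall i, invariant U (sigma i);
  dec_split : let e := j \o iota in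
    let fa := polarization D n n f in
    let xi := polarization D n n.-1 f in
    let eta := bracket h (x o) (y o) (x a) (y a) in
    exists u : 'I_n.+1 -> H,
      [/\ forall i, alg_of x y [set i | i != o] (u i),
          forall i, invariant U (e (u i)),
          e f = (e fa) ^- n * e (\sum_(i < n.+1) xi ^+ (n - i) * eta ^+ i * u i)
        & \sum_(i < n.+1) (e (u i))%:P * 'X^(n - i) =
          (e fa)%:P * \prod_(i < n) ('X - (sigma i)%:P) :> {poly S}];
  dec_factors : let e := j \o iota in
    e f = (e (polarization D n n f)) ^- n.-1 *
          \prod_(i < n) bracket h (e (x o)) (e (y o))
            (factor_coord (e gamma) (sigma i) (e (x a)))
            (factor_coord (e delta) (sigma i) (e (y a)))
}.

(** * Differential modules *)

Record bimodule (C : fieldType) (T : algType C) := {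
  bim_sort :> lmodType T;
  rscale : bim_sort -> T -> bim_sort;
  rscaleDl : forall m m' t, rscale (m + m') t = rscale m t + rscale m' t;
  rscaleDr : forall m s t, rscale m (s + t) = rscale m s + rscale m t;
  rscaleM : forall m s t, rscale m (s * t) = rscale (rscale m s) t;
  rscale1 : forall m, rscale m 1 = m;
  rscale_lscale : forall s m t, rscale (s *: m) t = s *: rscale m t;
  rscale_scalar : forall (c : C) m, rscale m c%:A = c%:A *: m
}.

Notation "m <*: t" := (rscale m t) (at level 40, left associativity)
  : ring_scope.

Definition subbimodule (C : fieldType) (T : algType C) (M : bimodule T)
    (N : set M) : Prop :=
  [/\ N 0,
      forall m m', N m -> N m' -> N (m - m'),
      forall t m, N m -> N (t *: m)
    & forall t m, N m -> N (m <*: t)].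

Definition bimodule_morphism (C : fieldType) (T : algType C)
    (M N : bimodule T) (phi : M -> N) : Prop :=
  [/\ forall m m', phi (m + m') = phi m + phi m',
      forall t m, phi (t *: m) = t *: phi m
    & forall t m, phi (m <*: t) = phi m <*: t].

(* T is generated by the x_i, y_i and the set G of adjoined central elements.
   The differentiated defining relations of the elements of G follow from
   linearity and the Leibniz rule on T. *)
Record total_differential (C : fieldType) (h : C) (T : algType C) (I : Type)
    (x y : I -> T) (K : set I) (G : set T) (M : bimodule T) (d : T -> M) :
    Prop := {
  diff_linear : forall (c : C) s t, d (c *: s + t) = c%:A *: d s + d t;
  diff_leibniz : forall s t, d (s * t) = d s <*: t + s *: d t;
  diff_const : forall i, ~ K i -> d (x i) = 0 /\ d (y i) = 0;
  diff_rel : forall i j, K j ->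
    [/\ d (x j) <*: x i = x i *: d (x j) - (h *: x i) *: d (y j)
                          + (h *: y i) *: d (x j) + (h ^+ 2 *: y i) *: d (y j),
        d (y j) <*: y i = y i *: d (y j),
        d (x j) <*: y i = y i *: d (x j) + (h *: y i) *: d (y j)
      & d (y j) <*: x i = x i *: d (y j) - (h *: y i) *: d (y j)];
  diff_adjoined : forall g t, G g ->
    g *: d t = d t <*: g /\ t *: d g = d g <*: t
}.

(* (M, d) is the differential module T d_K T: the bimodule generated by the
   differentials of the generators, subject only to the relations making d a
   total differential. *)
Record differential_module (C : fieldType) (h : C) (T : algType C) (I : Type)
    (x y : I -> T) (K : set I) (G : set T) (M : bimodule T) (d : T -> M) :
    Prop := {
  dmod_diff : total_differential h x y K G d;
  dmod_gen : smallest (@subbimodule C T M)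
    (d @` ((x @` K) `|` (y @` K) `|` G)) = setT;
  dmod_univ : forall (N : bimodule T) (d' : T -> N),
    total_differential h x y K G d' ->
    exists phi : M -> N, bimodule_morphism phi /\ forall t, phi (d t) = d' t
}.

(* (dX, X) = dX Y - dY X - h dY Y *)
Definition dbracket (C : fieldType) (h : C) (T : algType C) (M : bimodule T)
    (d : T -> M) (X Y : T) : M :=
  d X <*: Y - d Y <*: X - (h%:A *: d Y) <*: Y.

Definition elliptic_differential (C : fieldType) (h : C) (T : unitAlgType C)
    (M : bimodule T) (d : T -> M) (w X Y : T) : M :=
  w^-1 *: dbracket h d X Y.

(* Main.v *)
(** Call two coordinate pairs p = (X, Y) and p' = (X', Y') compatible when they
    satisfy the relations of H_I; these are symmetric in the two pairs.  Then
    the brackets [p, p'] commute with every pair compatible with both, are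
    alternating, and satisfy the Pluecker relation
    p [q, r] + q [r, p] + r [p, q] = 0.  So everything takes place in a
    commutative ring Z of elements of T which are central in T and in the
    bimodule, and any family of Z-combinations of the generating pairs can be
    substituted for the generators.

    Substituting gamma - z a for the main index turns r into the cubic
    P(z) = - f_a prod_i (z - sigma_i), so that at a root p = (X_i, Y_i) one has
    [p1][p2][p3] = [p4][p5]^2 and w^(i) = +- [p4][p5].  Differentiating this
    equation, where 1, 2, 3, 4 are constant, and expressing each (dp, l) by the
    Pluecker relation through (dp, p) and (dp, a) gives
    prod_{j <> i} (sigma_i - sigma_j) (dX_i, X_i) = 2 [p4][p5] (p, d5),
    in which (p, d5) is affine in sigma_i; the claim is then Lagrange's identity
    sum_i sigma_i^k / prod_{j <> i} (sigma_i - sigma_j) = 0 for k = 0, 1.  The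
    roots are distinct because the discriminant of P comes from H_I and does not
    vanish after the pair with index 4 is replaced by 0. *)

Require Import Defs.
From HB Require Import structures.
From mathcomp Require Import all_boot all_order all_algebra.
From mathcomp Require Import boolp classical_sets reals.
From mathcomp Require Import ring.

Set Implicit Arguments.
Unset Strict Implicit.
Unset Printing Implicit Defensive.

Import Order.TTheory GRing.Theory Num.Theory.

Local Open Scope classical_set_scope.
Local Open Scope ring_scope.

(** * Coordinate pairs *)

Definition pbr (C : fieldType) (A : algType C) (h : C) (p q : A * A) : A :=
  bracket h p.1 p.2 q.1 q.2.

(* The relations of H_I between two coordinate pairs, in a form that does not
   depend on which of the two indices is the smaller one. *)
Definition compatible (C : fieldType) (A : algType C) (h : C)
    (p q : A * A) : Prop :=
  [/\ p.1 * q.2 = q.2 * p.1 + h *: (p.2 * q.2),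
      q.1 * p.2 = p.2 * q.1 + h *: (q.2 * p.2),
      p.2 * q.2 = q.2 * p.2
    & q.1 * p.1 = p.1 * q.1 - h *: (q.2 * p.1 - p.2 * q.1)].

Section Pairs.
Variables (C : fieldType) (A : algType C) (h : C).
Implicit Types p q r s : A * A.

Lemma compatible_sym p q : compatible h p q -> compatible h q p.
Proof.
by case=> a b c d; split => //; rewrite d -[X in _ - X]opprK -scalerN opprB opprK addrK.
Qed.

(** Moving [q.2] to the left of [p.1] absorbs the term in [h]; in this form the bracket is visibly
    alternating. *)
Lemma pbrE p q : compatible h p q -> pbr h p q = q.2 * p.1 - p.2 * q.1.
Proof.
by case=> a _ _ _; rewrite /pbr /bracket a addrAC addrK.
Qed.

Lemma pbrC p q : compatible h p q -> pbr h q p = - pbr h p q.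
Proof.
by move=> pq; rewrite pbrE ?(pbrE pq) ?opprB //; apply: compatible_sym.
Qed.

Lemma pbr_comm2 p q r : compatible h p q -> compatible h p r -> compatible h q r ->
  pbr h p q * r.2 = r.2 * pbr h p q.
Proof.
move=> pq [a _ b _] [c _ d _]; case: (pq) => _ _ e _.
rewrite pbrE // mulrBl mulrBr -!mulrA a c !mulrDr !mulrA b d -!scalerAr !mulrA.
have -> : q.2 * r.2 * p.2 = p.2 * r.2 * q.2.
  by rewrite -(mulrA q.2) -b mulrA -e -!mulrA d.
by rewrite opprD addrACA subrr addr0.
Qed.

(* The correction term is symmetric in p and q, hence cancels in [p, q]. *)
Lemma compatible_half p q r : compatible h p q -> compatible h p r ->
  compatible h q r ->
  r.1 * (q.2 * p.1) = q.2 * p.1 * r.1 + h *: (q.2 * p.2 * r.1).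
Proof.
move=> pq [a a' b c] [d d' e f].
rewrite mulrA d' mulrDl -mulrA c mulrBr mulrA -!scalerAl -!scalerAr mulrBr scalerBr.
by rewrite !mulrA -e opprB addrA addrNK.
Qed.

Lemma pbr_comm1 p q r : compatible h p q -> compatible h p r -> compatible h q r ->
  pbr h p q * r.1 = r.1 * pbr h p q.
Proof.
move=> pq pr qr; rewrite pbrE // mulrBr (compatible_half pq pr qr).
rewrite (compatible_half (compatible_sym pq) qr pr) mulrBl.
by case: pq => _ _ -> _; rewrite opprD addrACA subrr addr0.
Qed.

(** Written as in [pbrE], the brackets leave six monomials, which cancel in pairs because second
    coordinates commute. *)
Lemma plucker2 p q r : compatible h p q -> compatible h q r -> compatible h p r ->
  p.2 * pbr h q r + q.2 * pbr h r p + r.2 * pbr h p q = 0.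
Proof.
move=> pq qr pr; rewrite (pbrC pr) !pbrE // !(mulrN, mulrBr) !mulrA.
case: pq qr pr => _ _ -> _ [_ _ -> _] [_ _ -> _].
set u := r.2 * p.2 * _; set v := q.2 * p.2 * _; set w := r.2 * q.2 * _.
by rewrite opprB !subrKA subrr.
Qed.

(** First coordinates commute only up to [h] times the bracket. Once the brackets stand on the left,
    the sum consists of such commutators, and these add up to [h] times the relation for second
    coordinates in the order [r], [q], [p]. *)
Lemma plucker1 p q r : compatible h p q -> compatible h q r -> compatible h p r ->
  p.1 * pbr h q r + q.1 * pbr h r p + r.1 * pbr h p q = 0.
Proof.
move=> pq qr pr; have qp := compatible_sym pq.
have rq := compatible_sym qr; have rp := compatible_sym pr.
have e (u v : A * A) : compatible h u v -> u.1 * v.1 - v.1 * u.1 = h *: pbr h u v.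
  by move=> uv; rewrite (pbrE uv); case: uv => _ _ _ ->; rewrite opprB addrC subrK.
rewrite -(pbr_comm1 qr qp rp) -(pbr_comm1 rp rq pq) -(pbr_comm1 pq pr qr).
rewrite (pbrE qr) (pbrE rp) (pbrE pq) !mulrBl -!mulrA.
have := plucker2 rq qp rp; move/(congr1 ( *:%R h)).
rewrite scaler0 !scalerDr !scalerAr -!e // !mulrBr => <-.
by rewrite [LHS](AC (2*2*2) (1*4*(5*2)*(3*6))).
Qed.

Definition pcomb (z : A) (p q : A * A) : A * A := (z * p.1 + q.1, z * p.2 + q.2).

Lemma pbr_combl z p q r : pbr h (pcomb z p q) r = z * pbr h p r + pbr h q r.
Proof.
rewrite /pbr /bracket /= !mulrDl !mulrBr -!scalerAr !mulrA scalerDr !opprD.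
by rewrite [LHS](AC (2*2*2) (1*3*5*(2*4*6))).
Qed.

Lemma compatible_comb z p q r : (forall t, z * t = t * z) ->
  compatible h p r -> compatible h q r -> compatible h (pcomb z p q) r.
Proof.
move=> zC [a b c d] [a' b' c' d'].
have mE t u : t * (z * u) = z * (t * u) by rewrite mulrA -zC mulrA.
split => /=.
- by rewrite !mulrDl !mulrDr mE -!mulrA a a' mulrDr scalerDr -!scalerAr addrACA.
- by rewrite !mulrDl !mulrDr !mE -!mulrA b b' mulrDr scalerDr -!scalerAr addrACA.
- by rewrite !mulrDl !mulrDr !mE -!mulrA c c'.
- rewrite !mulrDl !mulrDr !mE -!mulrA d d' opprD [in RHS]addrACA -mulrBr [in RHS]scalerDr.
  by rewrite [in LHS]mulrBr -!scalerAr opprD addrACA.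
Qed.

End Pairs.

(** * Compatible families as substitutions into H_I *)

Section Relations.
Variables (C : fieldType) (h : C) (disp : Order.disp_t) (I : orderType disp).

Lemma H_relations_compatible (A : algType C) (x y : I -> A) :
  H_relations h x y -> forall i j, compatible h (x i, y i) (x j, y j).
Proof.
case=> rd rel; have lt_compat i j : (i < j)%O -> compatible h (x i, y i) (x j, y j).
  move=> /rel[a b c d]; split=> //=.
  - by rewrite b subrK.
  - by rewrite a c.
  - by rewrite d b !scalerBr scalerA -expr2 !opprB !addrA [LHS](ACl (1*3*4*2)).
move=> i j; case: (ltgtP i j) => [|/lt_compat/compatible_sym //|->]; first exact: lt_compat.
by split; rewrite //= ?rd // subrr scaler0 subr0.
Qed.

Lemma compatible_H_relations (A : algType C) (q : I -> A * A) :
  (forall i j, compatible h (q i) (q j)) ->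
  H_relations h (fun i => (q i).1) (fun i => (q i).2).
Proof.
move=> qP; split=> [i|i j _]; first by case: (qP i i).
case: (qP i j) => a b c d; split; rewrite ?c //; last 1 first.
  by rewrite d a scalerBr scalerDr scalerA -expr2 c opprB opprD !addrA
    [RHS](ACl (1*4*2*(3*5))) /= addNr addr0.
by rewrite a c addrK.
Qed.

(** This is the universal property of H_I restated without the order on the indices: every pairwise
    compatible family is a legitimate evaluation point. *)
Lemma H_substitution (H : algType C) (x y : I -> H) (A : algType C) (q : I -> A * A) :
  presented_H h x y -> (forall i j, compatible h (q i) (q j)) ->
  exists f : {lrmorphism H -> A}, forall i, f (x i) = (q i).1 /\ f (y i) = (q i).2.
Proof. by move=> HP qP; apply: H_univ HP _ _ _ (compatible_H_relations qP). Qed.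

(* A representation of the truncation of H_I above degree 2: the matrices of the
   pairs other than k and l vanish. *)
Lemma bracket_neq0 (H : algType C) (x y : I -> H) (k l : I) :
  presented_H h x y -> k != l -> bracket h (x k) (y k) (x l) (y l) != 0.
Proof.
move=> HP kl.
pose E (i j : 'I_4) : 'M[C]_4 := delta_mx i j.
pose o0 := @Ordinal 4 0 isT; pose o1 := @Ordinal 4 1 isT.
pose o2 := @Ordinal 4 2 isT; pose o3 := @Ordinal 4 3 isT.
(* As the pair at [k] has second coordinate 0, the bracket becomes the product of its first
   coordinate with the second coordinate at [l], which is [E o0 o3]. The entry at [E o0 o2] with
   factor [- h] is forced by the relation between the two first coordinates. *)
pose q i : 'M[C]_4 * 'M[C]_4 := if i == k then (E o0 o1 + E o2 o3, 0) else
  if i == l then (- (h *: E o0 o2), E o0 o2 + E o1 o3) else (0, 0).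
have EE a b c d : E a b * E c d = E a d *+ (b == c) by exact: mul_delta_mx_cond.
have sl (c : C) (u v : 'M[C]_4) : c *: u * v = c *: (u * v) by rewrite -scalerAl.
have sr (c : C) (u v : 'M[C]_4) : u * (c *: v) = c *: (u * v) by rewrite -scalerAr.
have EQ := (sl, sr, @scalerN _ 'M[C]_4, @opprK 'M[C]_4, @mulrDl 'M[C]_4, @mulrDr 'M[C]_4,
  @mulrN 'M[C]_4, @mulNr 'M[C]_4, @mulr0 'M[C]_4, @mul0r 'M[C]_4, EE, @mulr0n 'M[C]_4,
  @mulr1n 'M[C]_4, @addr0 'M[C]_4, @add0r 'M[C]_4, @scaler0 _ 'M[C]_4, @oppr0 'M[C]_4).
have qP i j : compatible h (q i) (q j).
  rewrite /q; case: (i == k); case: (j == k) => //=; case: (i == l); case: (j == l) => //=;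
  split=> //=; rewrite ?EQ //= ?EQ //; by rewrite addNr.
have [f fE] := H_substitution HP qP.
have [[fxk fyk] [fxl fyl]] := (fE k, fE l).
apply/eqP => /(congr1 f); rewrite /bracket linear0 !linearB linearZ !rmorphM /=.
rewrite fxk fyk fxl fyl /q eqxx eq_sym (negPf kl) eqxx /= !EQ /=.
move/matrixP/(_ o0 o3); rewrite !mxE /= => /eqP; by rewrite oner_eq0.
Qed.
End Relations.

(** * The commutative ring of bicentral elements *)

Section Bicenter.
Variables (C : fieldType) (T : unitAlgType C) (M : bimodule T).

Lemma rscale0 (m : M) : m <*: 0 = 0.
Proof. by apply: (addrI (m <*: 0)); rewrite -rscaleDr !addr0. Qed.

Lemma rscaleN (m : M) t : m <*: (- t) = - (m <*: t).
Proof. by apply: (addrI (m <*: t)); rewrite -rscaleDr !subrr rscale0. Qed.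

Lemma rscaleB (m : M) s t : m <*: (s - t) = m <*: s - m <*: t.
Proof. by rewrite rscaleDr rscaleN. Qed.

Lemma rscale_addl0 t : (0 : M) <*: t = 0.
Proof. by apply: (addrI (0 <*: t)); rewrite -rscaleDl !addr0. Qed.

Lemma rscaleNl (m : M) t : (- m) <*: t = - (m <*: t).
Proof. by apply: (addrI (m <*: t)); rewrite -rscaleDl !subrr rscale_addl0. Qed.

Definition bicentral : {pred T} := fun z =>
  `[< (forall t, z * t = t * z) /\ (forall m : M, m <*: z = z *: m) >].

Lemma bicentralP z : reflect
  ((forall t, z * t = t * z) /\ (forall m : M, m <*: z = z *: m)) (z \in bicentral).
Proof. exact: asboolP. Qed.

Fact bicentral_divring_closed : divring_closed bicentral.
Proof.
split.
- by apply/bicentralP; split=> [t|m]; rewrite ?mul1r ?mulr1 // rscale1 scale1r.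
- move=> u v /bicentralP[uC uM] /bicentralP[vC vM]; apply/bicentralP; split=> [t|m].
    by rewrite mulrBl mulrBr uC vC.
  by rewrite rscaleB scalerBl uM vM.
move=> u v /bicentralP[uC uM] /bicentralP[vC vM]; apply/bicentralP.
have vVC t : v^-1 * t = t * v^-1 by apply/esym; apply: commrV; rewrite /GRing.comm vC.
have vVM (m : M) : m <*: v^-1 = v^-1 *: m.
  have [vU|/invr_out->//] := boolP (v \is a GRing.unit).
  rewrite -{1}[m](scale1r) -(mulVr vU) -scalerA -vM rscale_lscale -rscaleM.
  by rewrite divrr // rscale1.
split=> [t|m]; first by rewrite -mulrA vVC !mulrA -uC.
by rewrite rscaleM uM rscale_lscale vVM scalerA.
Qed.
HB.instance Definition _ :=
  GRing.isDivringClosed.Build T bicentral bicentral_divring_closed.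

(** Packaging these elements as a commutative ring lets [ring] settle identities between brackets
    and roots although [T] is not commutative. *)
Record bicenter := Bicenter { bval :> T; bvalP : bval \in bicentral }.
HB.instance Definition _ := [isSub for bval].
HB.instance Definition _ := [Choice of bicenter by <:].
HB.instance Definition _ := [SubChoice_isSubUnitRing of bicenter by <:].

Fact bicenter_mulC : @commutative bicenter bicenter *%R.
Proof.
move=> u v; apply: val_inj; rewrite !rmorphM /=.
by case/bicentralP: (bvalP u).
Qed.
HB.instance Definition _ := GRing.PzRing_hasCommutativeMul.Build bicenter bicenter_mulC.

Lemma bicentralC (z : bicenter) t : bval z * t = t * bval z.
Proof. by case/bicentralP: (bvalP z). Qed.

Lemma bicentralM (z : bicenter) (m : M) : m <*: bval z = bval z *: m.
Proof. by case/bicentralP: (bvalP z). Qed.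


Inductive bispan (J : Type) (g : J -> T * T) : T * T -> Prop :=
| bispan_gen i : bispan g (g i)
| bispan0 : bispan g (0, 0)
| bispan_comb (z : bicenter) p q : bispan g p -> bispan g q ->
    bispan g (pcomb (bval z) p q).

Section Span.
Variables (h : C) (J : Type) (g : J -> T * T).
Hypothesis g_compat : forall i j, compatible h (g i) (g j).
Hypothesis g_br : forall i j, pbr h (g i) (g j) \in bicentral.

Lemma bispan_compatible p q : bispan g p -> bispan g q -> compatible h p q.
Proof.
have c0 (r : T * T) : compatible h (0, 0) r.
  by split; rewrite /= ?(mul0r, mulr0) ?subrr ?scaler0 ?subr0 ?addr0.
move=> pP qP; elim: pP => {p} [i||z p p' _ IHp _ IHp'] //.
- elim: qP => {q} [j||z q q' _ IHq _ IHq'] //; first exact/compatible_sym.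
  apply/compatible_sym/compatible_comb; [exact: bicentralC| exact: compatible_sym..].
- by apply: compatible_comb; first exact: bicentralC.
Qed.

Lemma bispan_pbr p q : bispan g p -> bispan g q -> pbr h p q \in bicentral.
Proof.
have c0 (r : T * T) : pbr h (0, 0) r \in bicentral.
  by rewrite /pbr /bracket /= !mul0r scaler0 !subr0 rpred0.
have half i q' : bispan g q' -> pbr h q' (g i) \in bicentral.
  elim=> {q'} [j||z q1 q2 _ IH1 _ IH2] //; rewrite pbr_combl.
  by rewrite rpredD // rpredM // bvalP.
move=> pP qP; elim: pP => {p} [i||z p p' pP IHp pP' IHp'] //.
  rewrite pbrC ?rpredN ?half //; apply: bispan_compatible => //; exact: bispan_gen.
by rewrite pbr_combl rpredD // rpredM // bvalP.
Qed.
End Span.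
End Bicenter.

Lemma division_mulf_eq0 (T : unitRingType) (a b : T) :
  division_ring T -> a * b = 0 -> a = 0 \/ b = 0.
Proof.
move=> Td ab0; have [->|/Td aU] := eqVneq a 0; [by left | right].
by rewrite -[b](mulKr aU) ab0 mulr0.
Qed.

Lemma bracket_morph (C : fieldType) (A B : algType C) (h : C) (f : {lrmorphism A -> B})
    (u v u' v' : A) :
  f (bracket h u v u' v') = bracket h (f u) (f v) (f u') (f v').
Proof. by rewrite /bracket !linearB linearZ !rmorphM. Qed.

(** * Polarization *)

Section Derivation.
Variables (C : fieldType) (A : algType C) (D : A -> A).
Hypothesis D_linear : forall (c : C) u v, D (c *: u + v) = c *: D u + D v.
Hypothesis D_leibniz : forall u v, D (u * v) = D u * v + u * D v.

Lemma derivationD u v : D (u + v) = D u + D v.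
Proof. by rewrite -[u in LHS]scale1r D_linear scale1r. Qed.

Lemma derivation0 : D 0 = 0.
Proof. by apply: (addrI (D 0)); rewrite -derivationD !addr0. Qed.

Lemma derivationZ (c : C) u : D (c *: u) = c *: D u.
Proof. by rewrite -[c *: u]addr0 D_linear derivation0 addr0. Qed.

Lemma derivationB u v : D (u - v) = D u - D v.
Proof. by rewrite derivationD -scaleN1r derivationZ scaleN1r. Qed.

Lemma derivation_bracket h u v u' v' :
  D (bracket h u v u' v') = bracket h (D u) (D v) u' v' + bracket h u v (D u') (D v').
Proof.
rewrite /bracket !derivationB derivationZ !D_leibniz scalerDr !opprD !addrA.
by rewrite [LHS](ACl (1*3*5*2*4*6)).
Qed.

Lemma derivation_mul3 u v w :
  D (u * v * w) = D u * v * w + u * D v * w + u * v * D w.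
Proof. by rewrite !D_leibniz mulrDl. Qed.

Lemma derivation2_mul3 u v w : D (D u) = 0 -> D (D v) = 0 -> D (D w) = 0 ->
  D (D (u * v * w)) = (D u * D v * w + D u * v * D w + u * D v * D w) *+ 2.
Proof.
move=> u0 v0 w0; rewrite derivation_mul3 !derivationD !derivation_mul3 u0 v0 w0.
rewrite !(mul0r, mulr0, add0r, addr0) mulr2n !addrA.
by rewrite [LHS](ACl (1*2*4*3*5*6)).
Qed.

Lemma derivation3_mul3 u v w : D (D u) = 0 -> D (D v) = 0 -> D (D w) = 0 ->
  D (D u * D v * w + D u * v * D w + u * D v * D w) = (D u * D v * D w) *+ 3.
Proof.
move=> u0 v0 w0; rewrite !derivationD !derivation_mul3 u0 v0 w0.
by rewrite !(mul0r, mulr0, add0r, addr0) !mulrS mulr0n addr0 addrA.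
Qed.

Variables u v w s t : A.
Hypothesis D2 : [/\ D (D u) = 0, D (D v) = 0, D (D w) = 0, D (D s) = 0 & D (D t) = 0].
Hypothesis char0 : [pchar C] =i pred0.

(** The second derivative of a product of three factors killed by [D] twice carries a factor 2,
    which cancels against the normalisation 1/(3·2) and leaves 1/3. *)
Lemma polarization_cubic2 : polarization D 3 2 (u * v * w - s * t ^+ 2) =
  3%:R^-1 *: (D u * D v * w + D u * v * D w + u * D v * D w
              - (D s * D t * t + D s * t * D t + s * D t * D t)).
Proof.
case: D2 => u0 v0 w0 s0 t0; rewrite /= !derivationZ expr2 mulrA !derivationB.
rewrite !derivation2_mul3 // -mulrnBl scalerA -scaler_nat scalerA.
by rewrite mulrAC mulVf ?mul1r // ((pcharf0P C).1 char0).
Qed.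

Lemma polarization_cubic3 : polarization D 3 3 (u * v * w - s * t ^+ 2) =
  D u * D v * D w - D s * D t ^+ 2.
Proof.
have -> : polarization D 3 3 (u * v * w - s * t ^+ 2) =
  D (polarization D 3 2 (u * v * w - s * t ^+ 2)) by rewrite /= invr1 scale1r.
rewrite polarization_cubic2 derivationZ derivationB.
case: D2 => u0 v0 w0 s0 t0; rewrite !derivation3_mul3 // -mulrnBl -scaler_nat scalerA.
by rewrite mulVf ?scale1r ?expr2 ?mulrA // ((pcharf0P C).1 char0).
Qed.
End Derivation.

(** Cramer's rule: the differences [d] and [g] satisfy [t.1 * d = t.2 * g] for [t = p] and [t = q],
    so [[p, q]] annihilates [d] and then [g]. The pairs [u] and [v] need not be compatible with
    anything, as is the case for (gamma, delta) at first. *)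
Lemma pair_determined (C : fieldType) (T : unitAlgType C) (h : C) (p q u v : T * T) :
  division_ring T -> compatible h p q -> pbr h p q != 0 ->
  pbr h p u = pbr h p v -> pbr h q u = pbr h q v -> u = v.
Proof.
move=> Td pq pq0 pE qE.
have lin (t : T * T) : pbr h t u = pbr h t v ->
    t.1 * (u.2 - v.2) = t.2 * (u.1 - v.1 + h *: (u.2 - v.2)).
  move/eqP; rewrite -subr_eq0 /pbr /bracket => /eqP E; apply/eqP; rewrite -subr_eq0.
  rewrite -[X in _ == X]E scalerBr !(mulrDr, mulrN) -!scalerAr !opprD !opprK !addrA.
  by rewrite [X in _ == X](ACl (1*4*2*5*3*6)).
have pl := lin _ pE; have ql := lin _ qE.
set d := u.2 - v.2 in pl ql; set g := u.1 - v.1 + _ in pl ql.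
have pqE := pbrE pq; case: (pq) => _ b c _.
have d0 : d = 0.
  have : pbr h p q * d = 0 by rewrite pqE mulrBl -!mulrA pl ql !mulrA c subrr.
  by case/(division_mulf_eq0 Td) => // /eqP; rewrite (negPf pq0).
have p2g : p.2 * g = 0 by rewrite -pl d0 mulr0.
have q2g : q.2 * g = 0 by rewrite -ql d0 mulr0.
have g0 : g = 0.
  have : pbr h p q * g = 0.
    (* Every term of [[p, q]] is brought to end in [p.2] or [q.2], both of which kill [g]. *)
    rewrite /pbr /bracket -[p.2 * q.1](addrK (h *: (q.2 * p.2))) -b !mulrBl -!scalerAl.
    by rewrite -!mulrA p2g q2g !mulr0 scaler0 !subr0.
  by case/(division_mulf_eq0 Td) => // /eqP; rewrite (negPf pq0).
move: d0 g0; rewrite /g -/d => d0; rewrite d0 scaler0 addr0.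
move/eqP; rewrite subr_eq0 => /eqP u1; move/eqP: d0; rewrite subr_eq0 => /eqP u2.
by rewrite (surjective_pairing u) u1 u2 -surjective_pairing.
Qed.

(** * The cubic form and its roots *)

Section Core.
Variables (C : fieldType) (h : C) (disp : Order.disp_t) (I : orderType disp).
Variables (H : algType C) (x y : I -> H) (T : unitAlgType C) (M : bimodule T).
Variable (e : {lrmorphism H -> T}).
Hypothesis HP : presented_H h x y.
Hypothesis T_div : division_ring T.
Hypothesis e_inj : injective e.
Hypothesis e_br : forall i j, e (bracket h (x i) (y i) (x j) (y j)) \in bicentral M.
Let Z := bicenter M.

Lemma bicenter_mulf_eq0 (u v : Z) : u * v = 0 -> u = 0 \/ v = 0.
Proof.
move/(congr1 val); rewrite rmorphM rmorph0 => /(division_mulf_eq0 T_div).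
by case=> uv0; [left|right]; apply: val_inj; rewrite rmorph0.
Qed.

Lemma bicenter_mulf_neq0 (u v : Z) : u != 0 -> v != 0 -> u * v != 0.
Proof.
by move=> /eqP u0 /eqP v0; apply/eqP => /bicenter_mulf_eq0[].
Qed.

Lemma bicenter_unit (u : Z) : u != 0 -> bval u \is a GRing.unit.
Proof.
by move=> u0; apply: T_div; apply: contra u0 => /eqP u0; apply/eqP/val_inj; rewrite rmorph0.
Qed.

Definition gen_pair i : T * T := (e (x i), e (y i)).

Lemma gen_pair_compatible i j : compatible h (gen_pair i) (gen_pair j).
Proof.
apply: (H_relations_compatible (x := fun i => e (x i)) (y := fun i => e (y i))).
have [r1 r2] := H_rel HP; split=> [k|k l /r2[a b c d]].
  by have := congr1 e (r1 k); rewrite linearD linearZ rmorphXn !rmorphM.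
move: (congr1 e a) (congr1 e b) (congr1 e c) (congr1 e d).
by rewrite !(linearB, linearD) !linearZ !rmorphM.
Qed.

Lemma gen_pair_pbr i j : pbr h (gen_pair i) (gen_pair j) \in bicentral M.
Proof. by rewrite /pbr /gen_pair /= -bracket_morph. Qed.

Definition spair := {p : T * T | bispan M gen_pair p}.
Implicit Types (u v w : spair) (z : Z) (q : I -> spair).

Definition sgen i : spair := exist _ _ (bispan_gen M gen_pair i).
Definition szero : spair := exist _ _ (bispan0 M gen_pair).
Definition scomb z u v : spair := exist _ _ (bispan_comb z (svalP u) (svalP v)).

Lemma spair_compatible u v : compatible h (sval u) (sval v).
Proof. exact: (bispan_compatible gen_pair_compatible (svalP u) (svalP v)). Qed.

(** The default 0 of [insubd] is never taken: brackets of spanned pairs are bicentral. *)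
Definition zbr u v : Z := insubd 0 (pbr h (sval u) (sval v)).

Lemma bval_zbr u v : bval (zbr u v) = pbr h (sval u) (sval v).
Proof.
by apply: insubdK; apply: (bispan_pbr gen_pair_compatible gen_pair_pbr (svalP u) (svalP v)).
Qed.

Lemma zbr_combl z u v w : zbr (scomb z u v) w = z * zbr u w + zbr v w.
Proof. by apply: val_inj; rewrite rmorphD rmorphM /= !bval_zbr pbr_combl. Qed.

Lemma zbrC u v : zbr v u = - zbr u v.
Proof. by apply: val_inj; rewrite rmorphN /= !bval_zbr; exact/pbrC/spair_compatible. Qed.

Lemma zbr_combr z u v w : zbr w (scomb z u v) = z * zbr w u + zbr w v.
Proof. by rewrite zbrC zbr_combl (zbrC w) (zbrC w v) mulrN -opprD opprK. Qed.

Lemma zbr0r u : zbr u szero = 0.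
Proof. by apply: val_inj; rewrite rmorph0 /= bval_zbr /pbr /bracket /= !mulr0 scaler0 !subr0. Qed.

Lemma zbr_id u : zbr u u = 0.
Proof.
apply: val_inj; rewrite rmorph0 /= bval_zbr pbrE; last exact: spair_compatible.
by rewrite subrr.
Qed.

Lemma spair_plucker u v w :
  (sval u).1 * bval (zbr v w) + (sval v).1 * bval (zbr w u) + (sval w).1 * bval (zbr u v) = 0 /\
  (sval u).2 * bval (zbr v w) + (sval v).2 * bval (zbr w u) + (sval w).2 * bval (zbr u v) = 0.
Proof.
by rewrite !bval_zbr; split; [apply: plucker1 | apply: plucker2]; exact: spair_compatible.
Qed.

Lemma zbr_plucker t u v w :
  zbr u t * zbr v w + zbr v t * zbr w u + zbr w t * zbr u v = 0.
Proof.
have [E1 E2] := spair_plucker u v w.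
(* The vanishing combination of [u], [v], [w] is bracketed with the fourth pair [t]. *)
pose s := scomb (zbr v w) u (scomb (zbr w u) v (scomb (zbr u v) w szero)).
have s0 : sval s = (0, 0).
  by rewrite /s /= /pcomb /= !addr0 !bicentralC !addrA E1 E2.
have : zbr s t = 0.
  by apply: val_inj; rewrite rmorph0 /= bval_zbr s0 /pbr /bracket /= !mul0r scaler0 !subr0.
rewrite !zbr_combl (zbrC t szero) zbr0r oppr0 addr0 => <-; ring.
Qed.

Definition substitutes q (f : {lrmorphism H -> T}) : Prop :=
  forall i, f (x i) = (sval (q i)).1 /\ f (y i) = (sval (q i)).2.

Lemma substitution q : exists f, substitutes q f.
Proof.
have qP i j : compatible h (sval (q i)) (sval (q j)) by exact: spair_compatible.
by have [f fE] := H_substitution HP qP; exists f.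
Qed.

Lemma substitutes_gen : substitutes sgen e.
Proof. by []. Qed.

Lemma substitutes_br q f i j : substitutes q f ->
  f (bracket h (x i) (y i) (x j) (y j)) = val (zbr (q i) (q j)).
Proof.
move=> fq; rewrite bracket_morph.
by have [-> ->] := fq i; have [-> ->] := fq j; rewrite /= bval_zbr.
Qed.

Fact scalar_bicentral (c : C) : c%:A \in bicentral M.
Proof.
by apply/bicentralP; split=> [t|m]; rewrite ?rscale_scalar // mulr_algl mulr_algr.
Qed.
Definition zscalar (c : C) : Z := Bicenter (scalar_bicentral c).

Variables (char0 : [pchar C] =i pred0).

Lemma znat_neq0 n : n.+1%:R != 0 :> Z.
Proof.
apply/eqP => /(congr1 val); rewrite rmorph_nat rmorph0 -scaler_nat.
by move/eqP; rewrite scaler_eq0 oner_eq0 orbF ((pcharf0P C).1 char0).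
Qed.

Lemma third_mul3 : zscalar 3%:R^-1 * 3%:R = 1.
Proof.
apply: val_inj; rewrite rmorphM rmorph_nat rmorph1 /= mulr_algl -scaler_nat scalerA.
by rewrite mulVf ?scale1r // ((pcharf0P C).1 char0).
Qed.

(** * The cubic form and its polarizations under substitution *)

Section Form.
Local Arguments polarization : simpl never.
Variables (o i1 i2 i3 i4 i5 a : I).

(* The pair (gamma, delta), read off from the second polarization of r. *)
Definition gammaV q : spair :=
  let c k l := zscalar 3%:R^-1 * zbr (q a) (q k) * zbr (q a) (q l) in
  scomb (c i2 i3) (q i1) (scomb (c i1 i3) (q i2) (scomb (c i1 i2) (q i3)
    (scomb (- c i5 i5) (q i4) (scomb (- 2%:R * c i4 i5) (q i5) szero)))).

Definition cubic u q : Z :=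
  zbr u (q i1) * zbr u (q i2) * zbr u (q i3) - zbr u (q i4) * zbr u (q i5) ^+ 2.

Local Arguments gammaV : simpl never.
Local Arguments cubic : simpl never.

(** Euler's relation: polarizing and then inserting [a] gives three copies of the cubic at [a], each
    with factor 1/3. *)
Lemma zbr_gammaV q : zbr (q a) (gammaV q) = cubic (q a) q.
Proof.
rewrite !zbr_combr zbr0r.
transitivity (zscalar 3%:R^-1 * 3%:R * cubic (q a) q); last by rewrite third_mul3 mul1r.
by rewrite /cubic; ring.
Qed.


Hypothesis distinct : uniq [:: o; i1; i2; i3; i4; i5; a].

Let b k l := bracket h (x k) (y k) (x l) (y l).
Let r := b o i1 * b o i2 * b o i3 - b o i4 * b o i5 ^+ 2.
Variable D : H -> H.
Hypothesis D_Delta : is_Delta x y o a D.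
Let F := cubic (sgen a) sgen.
Let Gam := gammaV sgen.

Lemma index_neq :
  [/\ i1 != o, i2 != o, i3 != o & [/\ i4 != o, i5 != o & a != o]].
Proof.
move: distinct; rewrite /= !inE !negb_or -!(eq_sym o).
by case/andP=> /andP[-> /and5P[-> -> -> -> ->]].
Qed.

Lemma Delta_bracket k l : k != o -> l != o -> D (b k l) = 0.
Proof.
case: D_Delta => DL DM _ D0 ko lo; rewrite (derivation_bracket DL DM).
have [-> ->] := D0 _ ko; have [-> ->] := D0 _ lo.
by rewrite /bracket !(mul0r, mulr0, scaler0, subr0, addr0).
Qed.

Lemma Delta_bracket_o l : l != o -> D (b o l) = b a l.
Proof.
case: D_Delta => DL DM [Dx Dy] D0 lo; rewrite (derivation_bracket DL DM) Dx Dy.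
have [-> ->] := D0 _ lo.
by rewrite /bracket !(mul0r, mulr0, scaler0, subr0, addr0).
Qed.

Lemma substitutes_form q f : substitutes q f -> f r = val (cubic (q o) q).
Proof.
move=> fq; rewrite linearB !rmorphM /= !(substitutes_br _ _ fq).
by rewrite -[RHS]/(val (cubic _ q)) /cubic rmorphB !rmorphM.
Qed.

Lemma substitutes_polarization3 q f : substitutes q f ->
  f (polarization D 3 3 r) = val (cubic (q a) q).
Proof.
move=> fq; have [n1 n2 n3 [n4 n5 na]] := index_neq; have [DL DM _ _] := D_Delta.
rewrite polarization_cubic3 //; last first.
  by split; rewrite Delta_bracket_o // Delta_bracket.
rewrite !Delta_bracket_o // linearB !rmorphM /= !(substitutes_br _ _ fq).
by rewrite -[RHS]/(val (cubic _ q)) /cubic rmorphB !rmorphM.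
Qed.

Lemma substitutes_polarization2 q f : substitutes q f ->
  f (polarization D 3 2 r) = val (zbr (q o) (gammaV q)).
Proof.
move=> fq; have [n1 n2 n3 [n4 n5 na]] := index_neq; have [DL DM _ _] := D_Delta.
pose A k := zbr (q a) (q k); pose O k := zbr (q o) (q k).
have -> : zbr (q o) (gammaV q) = zscalar 3%:R^-1 *
    (A i1 * A i2 * O i3 + A i1 * O i2 * A i3 + O i1 * A i2 * A i3
     - (A i4 * A i5 * O i5 + A i4 * O i5 * A i5 + O i4 * A i5 * A i5)).
  by rewrite !zbr_combr zbr0r /A /O; ring.
rewrite polarization_cubic2 //; last first.
  by split; rewrite Delta_bracket_o // Delta_bracket.
rewrite !Delta_bracket_o // linearZ linearB !linearD !rmorphM /= !(substitutes_br _ _ fq).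
by rewrite mulr_algl -!opprD.
Qed.

Lemma substitutes_alg q f (u : H) : substitutes q f -> (forall i, i != o -> q i = sgen i) ->
  alg_of x y [set i | i != o] u -> f u = e u.
Proof.
move=> fq qE; suff : alg_of x y [set i | i != o] `<=` [set t | f t = e t] by apply.
apply: smallest_sub => [|t [[i io <-]|[i io <-]]] /=.
- split=> [|c t t' /= tE t'E|t t' /= tE t'E] /=; rewrite ?rmorph1 //.
    by rewrite !linearP /= tE t'E.
  by rewrite !rmorphM /= tE t'E.
- by have [-> _] := fq i; rewrite qE.
by have [_ ->] := fq i; rewrite qE.
Qed.

Lemma cubic_ext u q : (forall i, i != o -> q i = sgen i) -> cubic u q = cubic u sgen.
Proof. by have [n1 n2 n3 [n4 n5 na]] := index_neq => qE; rewrite /cubic !qE. Qed.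

Lemma gammaV_ext q : (forall i, i != o -> q i = sgen i) -> gammaV q = Gam.
Proof. by have [n1 n2 n3 [n4 n5 na]] := index_neq => qE; rewrite /gammaV !qE. Qed.

(** Sending the main index to a generator [l] leaves [g] and [d] fixed and turns the equation into
    one for their bracket with [l]. The two choices [i1] and [i2] already determine the pair. *)
Lemma pbr_gamma_uniq (g d : H) : alg_of x y [set i | i != o] g ->
  alg_of x y [set i | i != o] d ->
  polarization D 3 2 r = bracket h (x o) (y o) g d ->
  e g = (sval Gam).1 /\ e d = (sval Gam).2.
Proof.
move=> gA dA xiE; have [n1 n2 _ _] := index_neq.
have Gl l : l != o -> pbr h (gen_pair l) (e g, e d) = pbr h (gen_pair l) (sval Gam).
  move=> lo; pose q i := if i == o then sgen l else sgen i.
  have qE i : i != o -> q i = sgen i by rewrite /q => /negPf ->.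
  have [f fq] := substitution q.
  have := congr1 f xiE; rewrite (substitutes_polarization2 fq) gammaV_ext //= bval_zbr.
  rewrite bracket_morph (substitutes_alg fq qE gA) (substitutes_alg fq qE dA).
  by have [-> ->] := fq o; rewrite /q eqxx.
have br12 : pbr h (gen_pair i1) (gen_pair i2) != 0.
  rewrite /pbr /= -bracket_morph -(rmorph0 e) (inj_eq e_inj); apply: bracket_neq0 HP _.
  by move: distinct; rewrite /= !inE !negb_or => /and3P[_ /andP[]].
by have <- := pair_determined T_div (gen_pair_compatible i1 i2) br12 (Gl _ n1) (Gl _ n2).
Qed.

(** Under substitution of [p = Gam - z a] for the main index, xi becomes [- z F] and eta becomes
    [- F]. The right side of the decomposition is then [- F ^+ 3] times the split polynomial at [z],
    the left side is [F ^+ 3] times the cubic at [p], and [F ^+ 3] cancels. *)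
Lemma cubic_factors (u : 'I_4 -> H) (pol : Z -> Z) :
  (forall i, alg_of x y [set i | i != o] (u i)) ->
  polarization D 3 3 r ^+ 3 * r =
    \sum_(i < 4) polarization D 3 2 r ^+ (3 - i) * b o a ^+ i * u i ->
  (forall z, \sum_(i < 4) e (u i) * bval z ^+ (3 - i) =
     val (F * pol z)) ->
  forall z, F != 0 -> cubic (scomb (- z) (sgen a) Gam) sgen = - F * pol z.
Proof.
(* An opaque [f0] replaces [F], so that [ring] sees an atom. *)
move=> uA rE; have [f0 f0E] : exists f0, f0 = F by exists F.
rewrite -f0E => uE z F0; have [_ _ _ [_ _ na]] := index_neq.
set p := scomb _ _ _; pose q i := if i == o then p else sgen i.
have qE i : i != o -> q i = sgen i by rewrite /q => /negPf ->.
have qo : q o = p by rewrite /q eqxx.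
have [f fq] := substitution q.
have aG : zbr (sgen a) Gam = f0 by rewrite f0E; exact: zbr_gammaV.
have pG : zbr p Gam = - z * f0 by rewrite zbr_combl zbr_id aG addr0.
have pa : zbr p (sgen a) = - f0 by rewrite zbr_combl zbr_id mulr0 add0r zbrC aG.
have fM (t t' t'' : H) m n : f (t ^+ m * t' ^+ n * t'') = f t ^+ m * f t' ^+ n * f t''.
  by rewrite !rmorphM !rmorphXn.
have := congr1 f rE; rewrite rmorphM rmorphXn /= (substitutes_polarization3 fq).
rewrite (substitutes_form fq) cubic_ext // qE // cubic_ext // -/F -f0E qo rmorph_sum.
have -> : \sum_(i < 4) f (polarization D 3 2 r ^+ (3 - i) * b o a ^+ i * u i) =
    val (- f0 ^+ 3) * \sum_(i < 4) e (u i) * bval z ^+ (3 - i).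
  rewrite mulr_sumr; apply: eq_bigr => i _.
  rewrite fM (substitutes_polarization2 fq) (substitutes_br _ _ fq).
  rewrite qo gammaV_ext // qE // pG pa (substitutes_alg fq qE) //.
  have -> : bval z ^+ (3 - i) = bval (z ^+ (3 - i)) by rewrite -[RHS]/(val _) rmorphXn.
  rewrite -!rmorphXn -bicentralC mulrA -!rmorphM.
  congr (val _ * _).
  rewrite mulNr -mulrN exprMn -mulrA -exprD subnK; last exact: ltnSE (ltn_ord i).
  by ring.
rewrite uE -!rmorphXn -!rmorphM => /val_inj E.
apply/eqP; rewrite -subr_eq0; apply/eqP.
have F30 : f0 ^+ 3 != 0 by rewrite !exprS expr0 mulr1 !bicenter_mulf_neq0.
have : f0 ^+ 3 * (cubic p sgen - - f0 * pol z) = 0.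
  by rewrite mulrBr E; ring.
by case/bicenter_mulf_eq0 => [/eqP|//]; rewrite (negPf F30).
Qed.

(* As e is injective, a realized expression in the brackets which is nonzero for
   some choice of pairs is nonzero for the generators. *)
Definition realized (Phi : (I -> spair) -> Z) : Prop :=
  exists t : H, forall q f, substitutes q f -> f t = val (Phi q).

Lemma realized_br k l : realized (fun q => zbr (q k) (q l)).
Proof. by exists (b k l) => q f fq; rewrite (substitutes_br _ _ fq). Qed.

Lemma realized_scalar c : realized (fun=> zscalar c).
Proof. by exists c%:A => q f fq; rewrite rmorph_alg. Qed.

Lemma realizedD (Phi Psi : (I -> spair) -> Z) : realized Phi -> realized Psi ->
  realized (fun q => Phi q + Psi q).
Proof.
move=> [t tE] [t' t'E]; exists (t + t') => q f fq.
by rewrite !rmorphD /= (tE _ _ fq) (t'E _ _ fq).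
Qed.

Lemma realizedM Phi Psi : realized Phi -> realized Psi ->
  realized (fun q => Phi q * Psi q).
Proof.
move=> [t tE] [t' t'E]; exists (t * t') => q f fq.
by rewrite !rmorphM /= (tE _ _ fq) (t'E _ _ fq).
Qed.

Lemma realizedN Phi : realized Phi -> realized (fun q => - Phi q).
Proof.
by move=> [t tE]; exists (- t) => q f fq; rewrite !rmorphN /= (tE _ _ fq).
Qed.

Lemma realizedX Phi n : realized Phi -> realized (fun q => Phi q ^+ n).
Proof.
by move=> [t tE]; exists (t ^+ n) => q f fq; rewrite !rmorphXn /= (tE _ _ fq).
Qed.

Lemma realized_nat n : realized (fun=> n%:R).
Proof. by exists n%:R => q f fq; rewrite !rmorph_nat. Qed.

Lemma realized_neq0 Phi q : realized Phi -> Phi q != 0 -> Phi sgen != 0.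
Proof.
move=> [t tE]; apply: contra => /eqP P0; have [f fq] := substitution q.
have t0 : t = 0.
  by apply: e_inj; rewrite (tE _ _ substitutes_gen) P0 !rmorph0.
by apply/eqP/val_inj; rewrite -(tE _ _ fq) t0 !rmorph0.
Qed.

Lemma zbr_gen_neq0 k l : k != l -> zbr (sgen k) (sgen l) != 0.
Proof.
move=> kl; apply/eqP => /(congr1 val); rewrite -(substitutes_br _ _ substitutes_gen).
rewrite !rmorph0 -(rmorph0 e) => /e_inj /eqP; apply/negP; exact: bracket_neq0.
Qed.

(** * The discriminant of the cubic and its nonvanishing *)

Let gA k q := zbr (q a) (q k).
Let gG k q := zbr (gammaV q) (q k).

Lemma realized_gG k : realized (gG k).
Proof.
have [t tP] : realized (fun q =>
    zscalar 3%:R^-1 * gA i2 q * gA i3 q * zbr (q i1) (q k) +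
    (zscalar 3%:R^-1 * gA i1 q * gA i3 q * zbr (q i2) (q k) +
    (zscalar 3%:R^-1 * gA i1 q * gA i2 q * zbr (q i3) (q k) +
    (- (zscalar 3%:R^-1 * gA i5 q * gA i5 q) * zbr (q i4) (q k) +
     - 2%:R * (zscalar 3%:R^-1 * gA i4 q * gA i5 q) * zbr (q i5) (q k))))).
  by do ![exact: realized_br | exact: realized_scalar | exact: realized_nat
        | apply: realizedN | apply: realizedD | apply: realizedM].
exists t => q f fq; rewrite (tP _ _ fq) /gG !zbr_combl (zbrC (q k) szero) zbr0r oppr0 addr0.
by [].
Qed.

(** [coef0] to [coef3] are the coefficients of the powers of [z] in the cubic at [Gam - z a], kept
    as functions of the substituted family; [disc] is the discriminant of that polynomial. *)
Definition coef0 q := gG i1 q * gG i2 q * gG i3 q + - (gG i4 q * gG i5 q ^+ 2).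
Definition coef1 q :=
  - (gA i1 q * gG i2 q * gG i3 q + gG i1 q * gA i2 q * gG i3 q + gG i1 q * gG i2 q * gA i3 q)
  + (gA i4 q * gG i5 q ^+ 2 + 2%:R * gG i4 q * gG i5 q * gA i5 q).
Definition coef2 q :=
  gA i1 q * gA i2 q * gG i3 q + gA i1 q * gG i2 q * gA i3 q + gG i1 q * gA i2 q * gA i3 q
  + - (gG i4 q * gA i5 q ^+ 2 + 2%:R * gA i4 q * gA i5 q * gG i5 q).
Definition coef3 q := - (gA i1 q * gA i2 q * gA i3 q + - (gA i4 q * gA i5 q ^+ 2)).
Definition disc q :=
  coef2 q ^+ 2 * coef1 q ^+ 2 + - (4%:R * coef3 q * coef1 q ^+ 3)
  + - (4%:R * coef2 q ^+ 3 * coef0 q) + - (27%:R * coef3 q ^+ 2 * coef0 q ^+ 2)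
  + 18%:R * coef3 q * coef2 q * coef1 q * coef0 q.

Lemma realized_disc : realized disc.
Proof.
have G := realized_gG; have A k : realized (gA k) := realized_br a k.
have n := realized_nat; have P := realizedM; have S := realizedD.
have N := realizedN; have X := realizedX.
have c0 : realized coef0.
  exact: S _ _ (P _ _ (P _ _ (G i1) (G i2)) (G i3)) (N _ (P _ _ (G i4) (X _ 2 (G i5)))).
have c1 : realized coef1.
  exact: S _ _ (N _ (S _ _ (S _ _ (P _ _ (P _ _ (A i1) (G i2)) (G i3))
      (P _ _ (P _ _ (G i1) (A i2)) (G i3)))
      (P _ _ (P _ _ (G i1) (G i2)) (A i3))))
    (S _ _ (P _ _ (A i4) (X _ 2 (G i5))) (P _ _ (P _ _ (P _ _ (n 2) (G i4)) (G i5)) (A i5))).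
have c2 : realized coef2.
  exact: S _ _ (S _ _ (S _ _ (P _ _ (P _ _ (A i1) (A i2)) (G i3))
      (P _ _ (P _ _ (A i1) (G i2)) (A i3)))
      (P _ _ (P _ _ (G i1) (A i2)) (A i3)))
    (N _ (S _ _ (P _ _ (G i4) (X _ 2 (A i5)))
      (P _ _ (P _ _ (P _ _ (n 2) (A i4)) (A i5)) (G i5)))).
have c3 : realized coef3.
  exact: N _ (S _ _ (P _ _ (P _ _ (A i1) (A i2)) (A i3)) (N _ (P _ _ (A i4) (X _ 2 (A i5))))).
exact: S _ _ (S _ _ (S _ _ (S _ _ (P _ _ (X _ 2 c2) (X _ 2 c1))
      (N _ (P _ _ (P _ _ (n 4) c3) (X _ 3 c1))))
    (N _ (P _ _ (P _ _ (n 4) (X _ 3 c2)) c0))) (N _ (P _ _ (P _ _ (n 27) (X _ 2 c3)) (X _ 2 c0))))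
  (P _ _ (P _ _ (P _ _ (P _ _ (n 18) c3) c2) c1) c0).
Qed.

Lemma index_neq_pairs :
  [/\ i1 != i2, i1 != i3, i2 != i3 & [/\ i1 != a, i2 != a, i3 != a
    & [/\ i1 != i4, i2 != i4, i3 != i4
    & [/\ i1 != i5, i2 != i5, i3 != i5 & i4 != a /\ i4 != i5]]]].
Proof.
by move: distinct; rewrite /= !inE !negb_or -!andbA; do ![case/andP=> ?].
Qed.

(** The test family: it removes the second term of the form, so the cubic becomes a product of three
    brackets. *)
Let kill4 i := if i == i4 then szero else sgen i.

Lemma cubic_kill4 : cubic (kill4 a) kill4 =
  zbr (sgen a) (sgen i1) * zbr (sgen a) (sgen i2) * zbr (sgen a) (sgen i3).
Proof.
have [_ _ _ [_ _ _ [n1 n2 n3 [_ _ _ [n4 n5]]]]] := index_neq_pairs.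
rewrite /cubic /kill4 eqxx zbr0r mul0r subr0 (negPf n1) (negPf n2) (negPf n3).
by rewrite eq_sym (negPf n4).
Qed.

Lemma zbr_gen_a_neq0 k : k != a -> zbr (sgen a) (sgen k) != 0.
Proof. by move=> ka; apply: zbr_gen_neq0; rewrite eq_sym. Qed.

Lemma cubic_kill4_neq0 : cubic (kill4 a) kill4 != 0.
Proof.
have [_ _ _ [? ? ? _]] := index_neq_pairs.
by rewrite cubic_kill4 !bicenter_mulf_neq0 ?zbr_gen_a_neq0.
Qed.

Lemma F_neq0 : F != 0.
Proof.
apply: (realized_neq0 (Phi := fun q => cubic (q a) q) _ cubic_kill4_neq0).
have A k := realized_br a k.
exact: realizedD (realizedM (realizedM (A i1) (A i2)) (A i3))
  (realizedN (realizedM (A i4) (realizedX 2 (A i5)))).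
Qed.

(* With the index 4 killed the cubic splits off the brackets with 1, 2 and 3,
   so that its discriminant is a product of squares. *)
Lemma disc_kill4_neq0 : disc kill4 != 0.
Proof.
have [n12 n13 n23 [_ _ _ [n1 n2 n3 _]]] := index_neq_pairs.
have G4 : gG i4 kill4 = 0 by rewrite /gG /kill4 eqxx zbr0r.
have A4 : gA i4 kill4 = 0 by rewrite /gA /kill4 eqxx zbr0r.
(* [m k l] is the resultant of the linear factors [gG k - z gA k] and [gG l - z gA l]. *)
pose m k l := gG k kill4 * gA l kill4 - gG l kill4 * gA k kill4.
have -> : disc kill4 = (m i1 i2 * m i1 i3 * m i2 i3) ^+ 2.
  by rewrite /disc /coef0 /coef1 /coef2 /coef3 G4 A4 /m; ring.
have m0 k l : k != l -> k != i4 -> l != i4 -> m k l != 0.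
  move=> kl k4 l4.
  have -> : m k l = - cubic (kill4 a) kill4 * zbr (sgen k) (sgen l).
    rewrite -zbr_gammaV /m /gG /gA.
    have -> : kill4 k = sgen k by rewrite /kill4 (negPf k4).
    have -> : kill4 l = sgen l by rewrite /kill4 (negPf l4).
    (* The Pluecker relation reduces the resultant to the bracket of [a] with gamma, which is the
       cubic at [a], times the bracket of [k] and [l]. *)
    have := zbr_plucker (sgen l) (gammaV kill4) (kill4 a) (sgen k).
    rewrite (zbrC (gammaV kill4) (sgen k)) (zbrC (kill4 a) (gammaV kill4)) => E.
    by rewrite -[LHS]addr0 -E; ring.
  by rewrite bicenter_mulf_neq0 ?oppr_eq0 ?cubic_kill4_neq0 ?zbr_gen_neq0.
by rewrite expr2 !bicenter_mulf_neq0 ?m0.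
Qed.

Lemma cubic_coef z : cubic (scomb (- z) (sgen a) Gam) sgen =
  coef0 sgen + coef1 sgen * z + coef2 sgen * z ^+ 2 + coef3 sgen * z ^+ 3.
Proof.
have E k : zbr (scomb (- z) (sgen a) Gam) (sgen k) = - z * gA k sgen + gG k sgen.
  exact: zbr_combl.
by rewrite /cubic !E /coef0 /coef1 /coef2 /coef3; ring.
Qed.

Lemma bicenter_muln_eq0 n (z : Z) : n.+1%:R * z = 0 -> z = 0.
Proof. by case/bicenter_mulf_eq0 => // /eqP; rewrite (negPf (znat_neq0 n)). Qed.

(** The values at 0, 1, -1 and 2 suffice: [P(1) + P(-1)] isolates 2 [k2] and [P(2) - 2 P(1)]
    isolates 6 [k3], and 2 and 6 can be cancelled in characteristic zero. *)
Lemma cubic_coef_eq0 (k0 k1 k2 k3 : Z) :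
  (forall z, k0 + k1 * z + k2 * z ^+ 2 + k3 * z ^+ 3 = 0) ->
  [/\ k0 = 0, k1 = 0, k2 = 0 & k3 = 0].
Proof.
move=> k_eq; have k00 : k0 = 0 by rewrite -[RHS](k_eq 0); ring.
have k20 : k2 = 0.
  apply: (bicenter_muln_eq0 (n := 1)); 
  have E : k0 + k1 * 1 + k2 * 1 ^+ 2 + k3 * 1 ^+ 3
    + (k0 + k1 * -1 + k2 * (-1) ^+ 2 + k3 * (-1) ^+ 3) = 0 by rewrite !k_eq addr0.
  by rewrite -E k00; ring.
have k30 : k3 = 0.
  apply: (bicenter_muln_eq0 (n := 5)).
  have E : k0 + k1 * 2%:R + k2 * 2%:R ^+ 2 + k3 * 2%:R ^+ 3
    - 2%:R * (k0 + k1 * 1 + k2 * 1 ^+ 2 + k3 * 1 ^+ 3) = 0 by rewrite !k_eq mulr0 subr0.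
  by rewrite -E k00 k20; ring.
by split=> //; rewrite -(k_eq 1) k00 k20 k30; ring.
Qed.

(** * Symmetric functions and distinctness of the roots *)

Section Roots.
Variables s0 s1 s2 : Z.
Hypothesis cubic_roots : forall z,
  cubic (scomb (- z) (sgen a) Gam) sgen = - F * ((z - s0) * (z - s1) * (z - s2)).

(** Vieta's formulas, by comparing coefficients of two cubics that agree at every bicentral [z]. *)
Lemma coef_roots : [/\ coef0 sgen = F * s0 * s1 * s2,
  coef1 sgen = - F * (s0 * s1 + s0 * s2 + s1 * s2),
  coef2 sgen = F * (s0 + s1 + s2) & coef3 sgen = - F].
Proof.
pose k0 := coef0 sgen - F * s0 * s1 * s2.
pose k1 := coef1 sgen + F * (s0 * s1 + s0 * s2 + s1 * s2).
pose k2 := coef2 sgen - F * (s0 + s1 + s2); pose k3 := coef3 sgen + F.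
have [z|E0 E1 E2 E3] := @cubic_coef_eq0 k0 k1 k2 k3.
  rewrite -[RHS](subrr (- F * ((z - s0) * (z - s1) * (z - s2)))).
  rewrite -{1}cubic_roots cubic_coef /k0 /k1 /k2 /k3; ring.
split; apply/eqP; rewrite -subr_eq0 ?mulNr ?opprK; exact/eqP.
Qed.

Lemma disc_roots : disc sgen = F ^+ 4 * ((s0 - s1) * (s0 - s2) * (s1 - s2)) ^+ 2.
Proof. by have [E0 E1 E2 E3] := coef_roots; rewrite /disc E0 E1 E2 E3; ring. Qed.

Lemma roots_distinct : [/\ s0 != s1, s0 != s2 & s1 != s2].
Proof.
have := realized_neq0 realized_disc disc_kill4_neq0; rewrite disc_roots => d0.
by split; apply: contra d0 => /eqP ->; rewrite subrr !(mul0r, mulr0) expr2 !mulr0.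
Qed.

Lemma spair_plucker_comb u v w :
  sval (scomb (zbr v w) u (scomb (zbr w u) v (scomb (zbr u v) w szero))) = (0, 0).
Proof.
have [E1 E2] := spair_plucker u v w.
by rewrite /= /pcomb /= !addr0 !bicentralC !addrA E1 E2.
Qed.

(** * Bicentral linear combinations in the bimodule *)

Lemma zscaleA z z' (m : M) : bval z *: (bval z' *: m) = bval (z * z') *: m.
Proof. by rewrite scalerA -[bval (z * z')]/(val _) rmorphM. Qed.

Lemma zscaleDl z z' (m : M) : bval (z + z') *: m = bval z *: m + bval z' *: m.
Proof. by rewrite -scalerDl -[bval (z + z')]/(val _) rmorphD. Qed.

Lemma zscale0 (m : M) : bval (0 : Z) *: m = 0.
Proof. by rewrite -[bval 0]/(val _) rmorph0 scale0r. Qed.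

Lemma zscaleN z (m : M) : bval (- z) *: m = - (bval z *: m).
Proof. by rewrite -scaleNr -[bval (- z)]/(val _) rmorphN. Qed.

Lemma zscale_reg z (m : M) : z != 0 -> bval z *: m = 0 -> m = 0.
Proof.
by move=> /bicenter_unit zU zm; rewrite -[m]scale1r -(mulVr zU) -scalerA zm scaler0.
Qed.

(** The common denominator [z] stays on the left, so that coefficients are added and compared
    without inverses. *)
Definition zcomb z (m1 m2 m : M) (c c' : Z) : Prop :=
  bval z *: m = bval c *: m1 + bval c' *: m2.

Lemma zcombD z m1 m2 m m' c c' c1 c1' : zcomb z m1 m2 m c c' -> zcomb z m1 m2 m' c1 c1' ->
  zcomb z m1 m2 (m + m') (c + c1) (c' + c1').
Proof. by rewrite /zcomb scalerDr => -> ->; rewrite !zscaleDl addrACA. Qed.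

Lemma zcombZ z m1 m2 z' m c c' : zcomb z m1 m2 m c c' ->
  zcomb z m1 m2 (bval z' *: m) (z' * c) (z' * c').
Proof.
rewrite /zcomb => E.
by rewrite zscaleA (mulrC z z') -(zscaleA z' z) E scalerDr !zscaleA.
Qed.

(** Collected form of the differentiated relation [v1 v2 v3 = v4 v5 ^+ 2]: [e1] to [e4] stand for
    the differentials of [v1] to [v4], and [e5 + n] for that of [v5], whose index is not
    constant. *)
Lemma diff_relation_expand (v1 v2 v3 v4 v5 : Z) (e1 e2 e3 e4 e5 n : M) :
  bval v3 *: (bval v2 *: e1 + bval v1 *: e2) + bval (v1 * v2) *: e3 =
    bval v5 *: (bval v5 *: e4 + bval v4 *: (e5 + n)) + bval (v4 * v5) *: (e5 + n) ->
  bval (v2 * v3) *: e1 + bval (v1 * v3) *: e2 + bval (v1 * v2) *: e3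
    + bval (- v5 ^+ 2) *: e4 + bval (- (2%:R * v4 * v5)) *: e5
  = bval (2%:R * v4 * v5) *: n.
Proof.
rewrite !scalerDr !zscaleA !addrA (mulrC v3) (mulrC v3) (mulrC v5 v4) => ->.
have -> : 2%:R * v4 * v5 = v4 * v5 + v4 * v5 by ring.
rewrite !zscaleN expr2 !zscaleDl opprD !addrA [LHS](ACl (1*6*(2*7)*(4*8)*(3*5))) /=.
by rewrite !subrr !add0r.
Qed.

(** * The differentials *)

Section Differential.
Variables (G : set T) (Kd : set I) (d : T -> M).
Hypothesis d_total :
  total_differential h (fun i => e (x i)) (fun i => e (y i)) Kd G d.
Hypothesis const_index : [/\ ~ Kd i1, ~ Kd i2, ~ Kd i3 & ~ Kd i4].

Lemma diffD s t : d (s + t) = d s + d t.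
Proof. by rewrite -[s in LHS]scale1r (diff_linear d_total) scale1r scale1r. Qed.

Lemma diff0 : d 0 = 0.
Proof. by apply: (addrI (d 0)); rewrite -diffD !addr0. Qed.

Lemma diffZ (c : C) t : d (c *: t) = c%:A *: d t.
Proof. by rewrite -[c *: t]addr0 (diff_linear d_total) diff0 addr0. Qed.

Lemma diffB s t : d (s - t) = d s - d t.
Proof. by rewrite diffD -[- t]scaleN1r diffZ !scaleN1r. Qed.

Lemma diff_zM z z' : d (bval (z * z')) = bval z' *: d (bval z) + bval z *: d (bval z').
Proof.
by rewrite -[bval (z * z')]/(val _) rmorphM (diff_leibniz d_total) bicentralM.
Qed.

(** [dbr] and [brd] are the halves (du, v) and (u, dv) of the differential of a bracket. Arbitrary
    module elements replace the differentials, so each half is linear in the remaining pair. *)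
Definition dbr (m m' : M) u : M :=
  m <*: (sval u).2 - m' <*: (sval u).1 - (h%:A *: m') <*: (sval u).2.

Definition brd u (m m' : M) : M :=
  (sval u).1 *: m' - (sval u).2 *: m - h%:A *: ((sval u).2 *: m').

Lemma rscale_comb (m : M) z s t : m <*: (bval z * s + t) = bval z *: (m <*: s) + m <*: t.
Proof. by rewrite rscaleDr rscaleM bicentralM rscale_lscale. Qed.

Lemma dbr_comb m m' z u v : dbr m m' (scomb z u v) = bval z *: dbr m m' u + dbr m m' v.
Proof.
rewrite /dbr /= !rscale_comb !scalerBr !opprD !addrA.
by rewrite [LHS](ACl (1*3*5*2*4*6)).
Qed.

Lemma dbr_eq0 m m' u : sval u = (0, 0) -> dbr m m' u = 0.
Proof. by move=> u0; rewrite /dbr u0 /= !rscale0 !subr0. Qed.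

(** [dbr] is linear in its pair, and the Pluecker combination of pairs vanishes. *)
Lemma dbr_plucker m m' u v w :
  bval (zbr v w) *: dbr m m' u + bval (zbr w u) *: dbr m m' v
  + bval (zbr u v) *: dbr m m' w = 0.
Proof.
have := dbr_eq0 m m' (spair_plucker_comb u v w).
by rewrite !dbr_comb (dbr_eq0 m m' (erefl : sval szero = (0, 0))) addr0 addrA.
Qed.

Lemma brd_comb m m' z u v : brd (scomb z u v) m m' = bval z *: brd u m m' + brd v m m'.
Proof.
have hz (t : M) : h%:A *: (bval z *: t) = bval z *: (h%:A *: t).
  by rewrite !scalerA bicentralC.
rewrite /brd /= !scalerDl -!scalerA scalerDr hz !scalerBr !opprD !addrA.
by rewrite [LHS](ACl (1*3*5*2*4*6)).
Qed.

Lemma diff_zbr u v : d (bval (zbr u v)) =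
  dbr (d (sval u).1) (d (sval u).2) v + brd u (d (sval v).1) (d (sval v).2).
Proof.
rewrite bval_zbr /pbr /bracket !diffB diffZ !(diff_leibniz d_total).
rewrite /dbr /brd scalerDr !opprD !addrA rscale_lscale.
by rewrite [LHS](ACl (1*3*5*2*4*6)).
Qed.

Lemma diff_zbr_const u k : ~ Kd k ->
  d (bval (zbr u (sgen k))) = dbr (d (sval u).1) (d (sval u).2) (sgen k).
Proof.
move=> /(diff_const d_total)[dx dy]; rewrite diff_zbr /brd /= dx dy.
by rewrite !scaler0 !subr0 addr0.
Qed.

(** At [z = sigma_i] this is the pair of homogeneous coordinates (X_i, Y_i). *)
Definition root_pair z : spair := scomb (- z) (sgen a) Gam.
(* The derivative of (z - s0)(z - s1)(z - s2). *)
Definition rootq z := (z - s1) * (z - s2) + (z - s0) * (z - s2) + (z - s0) * (z - s1).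
Local Arguments root_pair : simpl never.

Lemma zbr_root_pair z k : zbr (root_pair z) (sgen k) = gG k sgen - z * gA k sgen.
Proof. by rewrite /root_pair zbr_combl addrC mulNr. Qed.

Lemma zbr_root_pair_a z : zbr (sgen a) (root_pair z) = F.
Proof.
by rewrite /root_pair zbr_combr zbr_id mulr0 add0r; exact: zbr_gammaV.
Qed.

(** Both sides are minus the derivative in [z] of the cubic at [root_pair z], computed from the
    brackets and from the roots. *)
Lemma root_derivative z (u := fun k => zbr (root_pair z) (sgen k)) :
  gA i1 sgen * u i2 * u i3 + u i1 * gA i2 sgen * u i3 + u i1 * u i2 * gA i3 sgen
  - (gA i4 sgen * u i5 ^+ 2 + 2%:R * u i4 * u i5 * gA i5 sgen) = F * rootq z.
Proof.
have [_ E1 E2 E3] := coef_roots.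
transitivity (- (coef1 sgen + 2%:R * coef2 sgen * z + 3%:R * coef3 sgen * z ^+ 2)).
  by rewrite /u !zbr_root_pair /coef1 /coef2 /coef3; ring.
by rewrite E1 E2 E3 /rootq; ring.
Qed.

Lemma diff_root z (p := root_pair z) (dp := dbr (d (sval p).1) (d (sval p).2)) :
  cubic p sgen = 0 ->
  bval (rootq z) *: dp p =
  bval (2%:R * zbr p (sgen i4) * zbr p (sgen i5)) *: brd p (d (e (x i5))) (d (e (y i5))).
Proof.
pose u k := zbr p (sgen k).
pose n := brd p (d (e (x i5))) (d (e (y i5))).
have [K1 K2 K3 K4] := const_index.
have du := diff_zbr_const p.
have du5 : d (bval (u i5)) = dp (sgen i5) + n by exact: diff_zbr.
move=> p0; have uE : u i1 * u i2 * u i3 = u i4 * u i5 * u i5.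
  by apply/eqP; rewrite -subr_eq0 -[X in _ == X]p0 /cubic expr2 mulrA.
have [f0 f0E] : exists f0, f0 = F by exists F.
(* The Pluecker relation for [k], [a] and [p] expresses (dp, k) through (dp, a) and (dp, p), with
   denominator [[a, p] = F]. *)
have lin_gen k : zcomb f0 (dp (sgen a)) (dp p) (dp (sgen k)) (- u k) (gA k sgen).
  rewrite /zcomb f0E -(zbr_root_pair_a z) -/p; apply/eqP; rewrite -subr_eq0; apply/eqP.
  rewrite -[RHS](dbr_plucker (d (sval p).1) (d (sval p).2) (sgen k) (sgen a) p).
  by rewrite /u /gA (zbrC (sgen a) (sgen k)) !zscaleN opprD opprK addrA.
pose E k := dp (sgen k).
have V1 : bval (u i2 * u i3) *: E i1 + bval (u i1 * u i3) *: E i2 + bval (u i1 * u i2) *: E i3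
    + bval (- u i5 ^+ 2) *: E i4 + bval (- (2%:R * u i4 * u i5)) *: E i5
    = bval (2%:R * u i4 * u i5) *: n.
  have : d (bval (u i1 * u i2 * u i3)) = d (bval (u i4 * u i5 * u i5)) by rewrite uE.
  rewrite !diff_zM (du _ K1) (du _ K2) (du _ K3) (du _ K4) du5.
  exact: diff_relation_expand.
pose W := 2%:R * u i4 * u i5; pose ui5 := u i5.
have := zcombD (zcombD (zcombD (zcombD (zcombZ (u i2 * u i3) (lin_gen i1))
  (zcombZ (u i1 * u i3) (lin_gen i2))) (zcombZ (u i1 * u i2) (lin_gen i3)))
  (zcombZ (- u i5 ^+ 2) (lin_gen i4))) (zcombZ (- W) (lin_gen i5)).
rewrite V1 /zcomb.
set c := (X in bval X *: dp (sgen a)); set c' := (X in bval X *: dp p).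
(* The form has degree three, so by Euler's relation the coefficient of (dp, a) is a multiple of the
   cubic at [p], which is 0. *)
have -> : c = 0.
  transitivity (- 3%:R * (u i1 * u i2 * u i3 - u i4 * u i5 * u i5)).
    by rewrite /c /W; ring.
  by rewrite uE subrr mulr0.
have -> : c' = f0 * rootq z by rewrite /c' /W f0E -root_derivative /u; ring.
rewrite zscale0 add0r -(zscaleA f0 (rootq z)) => V2.
apply/eqP; rewrite eq_sym -subr_eq0; apply/eqP/(@zscale_reg f0).
  by rewrite f0E F_neq0.
by rewrite (scalerBr _ _ (bval (rootq z) *: dp p)) V2 subrr.
Qed.

(** The Pluecker relation would give [[p, a] [k, l] = 0], whereas [[p, a] = - F] and [[k, l]] are
    nonzero. *)
Lemma root_pair_nondeg z k l : k != l -> zbr (root_pair z) (sgen k) = 0 ->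
  zbr (root_pair z) (sgen l) = 0 -> False.
Proof.
move=> kl uk ul; have := zbr_plucker (sgen a) (root_pair z) (sgen k) (sgen l).
rewrite uk mulr0 addr0 (zbrC (root_pair z) (sgen l)) ul oppr0 mulr0 addr0.
rewrite (zbrC (sgen a) (root_pair z)) zbr_root_pair_a => /bicenter_mulf_eq0.
have := F_neq0; have := zbr_gen_neq0 kl.
by move=> /eqP kl0 /eqP F0 [/eqP|//]; rewrite oppr_eq0 => /eqP.
Qed.

(** If [[p4][p5]] vanished, so would [[p1][p2][p3]], and [p] would have zero bracket with two
    distinct generators. *)
Lemma root_pair45_neq0 z : cubic (root_pair z) sgen = 0 ->
  zbr (root_pair z) (sgen i4) * zbr (root_pair z) (sgen i5) != 0.
Proof.
have [_ _ _ [_ _ _ [n1 n2 n3 [m1 m2 m3 _]]]] := index_neq_pairs.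
rewrite /cubic => u0; apply/eqP => c0.
have : zbr (root_pair z) (sgen i1) * zbr (root_pair z) (sgen i2)
       * zbr (root_pair z) (sgen i3) = 0.
  by move/eqP: u0; rewrite subr_eq0 expr2 mulrA c0 mul0r => /eqP.
have nd := @root_pair_nondeg z.
case/bicenter_mulf_eq0 => [/bicenter_mulf_eq0[]|] ul; case/bicenter_mulf_eq0: c0 => uk.
- exact: nd n1 ul uk.
- exact: nd m1 ul uk.
- exact: nd n2 ul uk.
- exact: nd m2 ul uk.
- exact: nd n3 ul uk.
- exact: nd m3 ul uk.
Qed.

Lemma elliptic_root z (w : T) (p := root_pair z) : cubic p sgen = 0 ->
  w ^+ 2 = bval (zbr p (sgen i1) * zbr p (sgen i2) * zbr p (sgen i3) * zbr p (sgen i4)) ->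
  exists (eps : int) (m : M), [/\ eps = 1 \/ eps = -1,
    (w^-1 *: dbr (d (sval p).1) (d (sval p).2) p) *~ eps = m
    & bval (rootq z) *: m = bval (2%:R : Z) *: brd p (d (e (x i5))) (d (e (y i5)))].
Proof.
move=> p0 w2; have c0 := root_pair45_neq0 p0; rewrite -/p in c0.
set c := _ * _ in c0; have cU := bicenter_unit c0.
have uE : zbr p (sgen i1) * zbr p (sgen i2) * zbr p (sgen i3) = c * zbr p (sgen i5).
  by apply/eqP; rewrite -subr_eq0 -[X in _ == X]p0 /cubic expr2 /c mulrA.
(* By the cubic equation [w ^+ 2 = c ^+ 2]; since [c] is central the difference of squares factors,
   and [w] is [c] up to the sign [eps]. *)
have wc : (w - bval c) * (w + bval c) = 0.
  have -> : (w - bval c) * (w + bval c) = w ^+ 2 - bval c * bval c.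
    by rewrite mulrBl !mulrDr bicentralC opprD addrA addrK.
  rewrite w2 uE -[bval c * bval c]/(val c * val c) -rmorphM.
  rewrite (_ : c * _ * _ = c * c) ?subrr //; by rewrite /c; ring.
pose m := (bval c)^-1 *: dbr (d (sval p).1) (d (sval p).2) p.
have [eps [epsP epsE]] : exists eps : int, (eps = 1 \/ eps = -1) /\
    (w^-1 *: dbr (d (sval p).1) (d (sval p).2) p) *~ eps = m.
  case/(division_mulf_eq0 T_div): wc => /eqP.
    by rewrite subr_eq0 => /eqP ->; exists 1; split; [left | rewrite mulr1z].
  rewrite addr_eq0 => /eqP ->; exists (-1); split; first by right.
  by rewrite mulrNz mulr1z invrN scaleNr opprK.
exists eps, m; split=> //.
have qm : bval c *: (bval (rootq z) *: m) =
    bval c *: (bval (2%:R : Z) *: brd p (d (e (x i5))) (d (e (y i5)))).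
  rewrite !zscaleA (mulrC c) -(zscaleA _ c) /m (scalerA (bval c)) divrr // scale1r.
  by rewrite diff_root // [in RHS]mulrC mulrA.
by rewrite -[LHS]scale1r -[RHS]scale1r -(mulVr cU) -!(scalerA _ (bval c)) qm.
Qed.

Lemma elliptic_sum (m0 m1 m2 : M)
  (n := fun z => brd (root_pair z) (d (e (x i5))) (d (e (y i5)))) :
  bval (rootq s0) *: m0 = bval (2%:R : Z) *: n s0 ->
  bval (rootq s1) *: m1 = bval (2%:R : Z) *: n s1 ->
  bval (rootq s2) *: m2 = bval (2%:R : Z) *: n s2 ->
  m0 + m1 + m2 = 0.
Proof.
have [n01 n02 n12] := roots_distinct.
pose V := (s0 - s1) * (s0 - s2) * (s1 - s2).
have V0 : V != 0 by rewrite !bicenter_mulf_neq0 ?subr_eq0.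
pose nA := brd (sgen a) (d (e (x i5))) (d (e (y i5))).
pose nG := brd Gam (d (e (x i5))) (d (e (y i5))).
have nE z : n z = bval (- z) *: nA + bval (1 : Z) *: nG by rewrite /n brd_comb scale1r.
have step z c m : V = c * rootq z -> bval (rootq z) *: m = bval (2%:R : Z) *: n z ->
    zcomb V nA nG m (c * (2%:R * - z)) (c * (2%:R * 1)).
  move=> VE; rewrite /zcomb VE nE scalerDr !zscaleA => E.
  by rewrite -(zscaleA c (rootq z)) E scalerDr !zscaleA.
(* At a root, [rootq] is the product of the differences with the other two roots, so the Vandermonde
   product [V] clears all three denominators. The cofactors sum to 0, also when weighted by the
   roots. *)
have V_0 : V = (s1 - s2) * rootq s0 by rewrite /V /rootq; ring.
have V_1 : V = (s2 - s0) * rootq s1 by rewrite /V /rootq; ring.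
have V_2 : V = (s0 - s1) * rootq s2 by rewrite /V /rootq; ring.
move=> /(step _ _ _ V_0) E0 /(step _ _ _ V_1) E1 /(step _ _ _ V_2) E2.
apply: (zscale_reg V0); rewrite (zcombD (zcombD E0 E1) E2).
set c := (X in bval X *: nA); set c' := (X in bval X *: nG).
have -> : c = 0 by rewrite /c; ring.
have -> : c' = 0 by rewrite /c'; ring.
by rewrite !zscale0 addr0.
Qed.
End Differential.
End Roots.

End Form.
End Core.

(** * Central elements of the tower of extensions *)

Section Bicentrality.
Variables (C : fieldType) (h : C) (T : unitAlgType C) (I : Type) (x y : I -> T).
Variables (K : set I) (G : set T) (M : bimodule T) (d : T -> M).
Hypothesis d_module : differential_module h x y K G d.

(** For central [z] the elements commuting with [z] form a subbimodule, so the generating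
    differentials suffice. *)
Lemma central_bicentral (z : T) : (forall t, z * t = t * z) ->
  (forall l, K l -> d (x l) <*: z = z *: d (x l) /\ d (y l) <*: z = z *: d (y l)) ->
  (forall g, G g -> d g <*: z = z *: d g) ->
  z \in bicentral M.
Proof.
move=> zC zxy zG; apply/bicentralP; split=> // m.
suff : setT `<=` [set m : M | m <*: z = z *: m] by apply.
rewrite -(dmod_gen d_module); apply: smallest_sub => /=
  [|_ [t [[[l Kl <-]|[l Kl <-]]|tG] <-]].
- split=> [|m1 m2 /= E1 E2|t m1 /= E1|t m1 /= E1] /=.
  + by rewrite rscale_addl0 scaler0.
  + by rewrite rscaleDl rscaleNl E1 E2 scalerBr.
  + by rewrite rscale_lscale E1 !scalerA zC.
  + by rewrite -rscaleM -zC rscaleM E1 rscale_lscale.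
- by case: (zxy _ Kl).
- by case: (zxy _ Kl).
exact: zG.
Qed.

Lemma adjoined_bicentral (z : T) : G z -> (forall t, z * t = t * z) -> z \in bicentral M.
Proof.
move=> Gz zC; have zd t : d t <*: z = z *: d t.
  by have [-> _] := diff_adjoined (dmod_diff d_module) t Gz.
by apply: central_bicentral => // l _.
Qed.

(** The correction terms are symmetric in [p] and [q], hence cancel in the bracket
    [y q * x p - y p * x q]. *)
Lemma diff_half p q l : K l ->
  d (x l) <*: (y q * x p) = (y q * x p) *: d (x l) + (h *: (y q * y p)) *: d (x l) /\
  d (y l) <*: (y q * x p) = (y q * x p) *: d (y l) - (h *: (y q * y p)) *: d (y l).
Proof.
move=> Kl; have [_ yq xq _] := diff_rel (dmod_diff d_module) q Kl.
have [xp _ _ yp] := diff_rel (dmod_diff d_module) p Kl.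
split; rewrite rscaleM.
  rewrite xq rscaleDl !rscale_lscale xp yp !(scalerDr, scalerN) !scalerA.
  rewrite -!scalerAl -!scalerAr scalerA -expr2.
  by rewrite addrA [LHS](ACl (1*3*(2*5)*(4*6))) /= addNr subrr !addr0.
by rewrite yq rscale_lscale yp scalerBr !scalerA -scalerAr.
Qed.

Lemma pbr_bicentral p q : compatible h (x p, y p) (x q, y q) ->
  (forall t, pbr h (x p, y p) (x q, y q) * t = t * pbr h (x p, y p) (x q, y q)) ->
  pbr h (x p, y p) (x q, y q) \in bicentral M.
Proof.
move=> pq zC; apply: central_bicentral => // [l Kl|g Gg]; last first.
  by have [_ ->] := diff_adjoined (dmod_diff d_module) (pbr h (x p, y p) (x q, y q)) Gg.
rewrite pbrE //=; case: pq => _ _ /= yC _.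
have [a b] := diff_half p q Kl; have [a' b'] := diff_half q p Kl.
rewrite !rscaleB a a' b b' yC !scalerBl; split.
  by rewrite opprD addrACA subrr addr0.
by rewrite opprB addrA addrNK.
Qed.
End Bicentrality.

Section Centrality.
Variables (C : fieldType) (T : unitAlgType C).

Lemma commutant_subalgebra (z : T) : subalgebra [set t : T | z * t = t * z].
Proof.
split=> [|c s t /= zs zt|s t /= zs zt] /=; first by rewrite mulr1 mul1r.
  by rewrite mulrDr mulrDl -scalerAr -scalerAl zs zt.
by rewrite mulrA zs -mulrA zt mulrA.
Qed.

Lemma smallest_subalgebra_preim (A : algType C) (f : {lrmorphism A -> T})
    (z : T) (B : set A) :
  (forall t, B t -> z * f t = f t * z) ->
  forall t, smallest (@subalgebra C A) B t -> z * f t = f t * z.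
Proof.
move=> BP t; suff : smallest (@subalgebra C A) B `<=` [set t | z * f t = f t * z] by apply.
apply: smallest_sub => //=; have [c1 c2 c3] := commutant_subalgebra z.
split=> [|c u v uP vP|u v uP vP] /=; first by rewrite rmorph1.
  by rewrite linearP; exact: c2.
by rewrite rmorphM; exact: c3.
Qed.
End Centrality.

Lemma division_morph_inj (A B : unitRingType) (f : {rmorphism A -> B}) :
  division_ring A -> injective f.
Proof.
move=> Ad u v fuv; apply/eqP; rewrite -subr_eq0; apply: contraTT (oner_neq0 B) => /Ad uvU.
by rewrite -(rmorph1 f) -(divrr uvU) rmorphM rmorphB fuv subrr mul0r eqxx.
Qed.

Section Tower.
Variables (C : fieldType) (H : algType C) (I : Type) (x y : I -> H).
Variables (Q : unitAlgType C) (iota : {lrmorphism H -> Q}).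
Variables (S : unitAlgType C) (j : {lrmorphism Q -> S}).
Variables (T : unitAlgType C) (k : {lrmorphism S -> T}).
Variables (J L : Type) (sigma : J -> S) (w : L -> T).
Hypothesis H_generated : alg_of x y setT = setT.
Hypothesis Q_quot : right_quotient_division_ring iota.
Hypothesis S_ext : central_extension j (range sigma).
Hypothesis T_ext : central_extension k (range w).

Lemma central_of_base z : (forall s, z * k s = k s * z) -> forall t, z * t = t * z.
Proof.
move=> zS t; have : smallest (@subalgebra C T) (range k `|` range w) t.
  by rewrite (cext_gen T_ext).
move: t; apply: (@smallest_subalgebra_preim C T T idfun) => t [[s _ <-]|wt] //=.
by rewrite (cext_central T_ext wt).
Qed.

Lemma adjoined_central i t : k (sigma i) * t = t * k (sigma i).
Proof.
move: t; apply: central_of_base => s.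
by rewrite -!rmorphM (cext_central S_ext) //; exists i.
Qed.

Lemma iota_unit u : u != 0 -> iota u \is a GRing.unit.
Proof.
move=> u0; apply: (quot_div Q_quot); rewrite -(rmorph0 iota).
by rewrite (inj_eq (quot_inj Q_quot)).
Qed.

(** Commutation climbs the tower: from the generators to H, through inverses to Q, and to S and T
    because the adjoined elements are central. *)
Lemma central_of_generators z :
  (forall l, z * k (j (iota (x l))) = k (j (iota (x l))) * z /\
             z * k (j (iota (y l))) = k (j (iota (y l))) * z) ->
  forall t, z * t = t * z.
Proof.
move=> zxy; apply: central_of_base => s.
have zH u : z * k (j (iota u)) = k (j (iota u)) * z.
  have : alg_of x y setT u by rewrite H_generated.
  move: u; apply: (@smallest_subalgebra_preim C T H (k \o (j \o iota))) =>
    _ [[l _ <-]|[l _ <-]] /=;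
  by case: (zxy l).
have : smallest (@subalgebra C S) (range j `|` range sigma) s.
  by rewrite (cext_gen S_ext).
move: s; apply: smallest_subalgebra_preim => _ [[q _ <-]|[i _ <-]]; last first.
  by rewrite adjoined_central.
have : fractions iota setT q by rewrite (quot_frac Q_quot).
move=> [u [v [_ _ v0 ->]]]; have vU := iota_unit v0.
rewrite !rmorphM (rmorphV _ vU) (rmorphV _ (rmorph_unit j vU)).
rewrite mulrA zH -!mulrA; congr (_ * _).
by apply: commrV; exact: zH.
Qed.
End Tower.

(** Evaluation is multiplicative at a central point, even over noncommuting coefficients. *)
Lemma horner_prod_central (A : nzRingType) (n : nat) (c : 'I_n -> A) (z : A) :
  (forall t, z * t = t * z) ->
  (\prod_(i < n) ('X - (c i)%:P)).[z] = \prod_(i < n) (z - c i).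
Proof.
move=> zC; rewrite (big_morph (fun p : {poly A} => p.[z]) (id1 := 1) (op1 := *%R)).
- by apply: eq_bigr => i _; rewrite hornerXsubC.
- by move=> p q; rewrite hornerM_comm // /comm_poly zC.
by rewrite hornerC.
Qed.

(** * Assembly of the theorem *)

Theorem theorem22 (R : realType) (h : R[i]) (h_neq0 : h != 0)
    (disp : Order.disp_t) (I : orderType disp)
    (H : algType R[i]) (x y : I -> H) (H_pres : presented_H h x y)
    (Q : unitAlgType R[i]) (iota : {lrmorphism H -> Q})
    (Q_quot : right_quotient_division_ring iota)
    (i0 i1 i2 i3 i4 i5 a : I)
    (distinct : uniq [:: i0; i1; i2; i3; i4; i5; a])
    (K : set I) (K05 : K i0 /\ K i5)
    (K1234 : [/\ ~ K i1, ~ K i2, ~ K i3 & ~ K i4])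
    (S : unitAlgType R[i]) (j : {lrmorphism Q -> S})
    (U : Uh_module_algebra h S)
    (U_gen : action_on_generators U (j \o iota \o x) (j \o iota \o y))
    (D : H -> H) (gamma delta : H) (sigma : 'I_3 -> S)
    (S_ext : central_extension j (range sigma))
    (r_dec :
      let br k l := bracket h (x k) (y k) (x l) (y l) in
      let r := br i0 i1 * br i0 i2 * br i0 i3 - br i0 i4 * br i0 i5 ^+ 2 in
      form_decomposition x y iota j U i0 a D r gamma delta sigma)
    (T : unitAlgType R[i]) (k : {lrmorphism S -> T}) (w : 'I_3 -> T)
    (T_ext : central_extension k (range w)) :
  let e := j \o iota in
  let X i := factor_coord (e gamma) (sigma i) (e (x a)) in
  let Y i := factor_coord (e delta) (sigma i) (e (y a)) in
  let brX i l := bracket h (X i) (Y i) (e (x l)) (e (y l)) in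
  forall
    (w_root : forall i,
      w i ^+ 2 = k (brX i i1 * brX i i2 * brX i i3 * brX i i4))
    (M : bimodule T) (d : T -> M)
    (M_diff : differential_module h (k \o e \o x) (k \o e \o y) K
                (range (k \o sigma) `|` range w) d),
  exists eps : 'I_3 -> int,
    (forall i, eps i = 1 \/ eps i = -1) /\
    \sum_(i < 3) elliptic_differential h d (w i) (k (X i)) (k (Y i)) *~ eps i
      = 0.
Proof.
move=> e X Y brX w_root M d M_diff.
pose f : {lrmorphism H -> T} := k \o (j \o iota).
have T_div := cext_div T_ext.
have f_inj : injective f.
  move=> u v /(division_morph_inj (cext_div S_ext)) /(division_morph_inj (quot_div Q_quot)).
  exact: quot_inj.
have compat l m : compatible h (f (x l), f (y l)) (f (x m), f (y m)).
  exact: gen_pair_compatible f H_pres l m.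
have f_br l m : f (bracket h (x l) (y l) (x m) (y m)) \in bicentral M.
  rewrite bracket_morph; apply: (pbr_bicentral M_diff (p := l) (q := m)).
    exact: compat.
  apply: (central_of_generators (H_gen H_pres) Q_quot S_ext T_ext) => n.
  have [lm ln mn] := And3 (compat l m) (compat l n) (compat m n).
  by split; [exact: pbr_comm1 lm ln mn | exact: pbr_comm2 lm ln mn].
have sigma_br i : k (sigma i) \in bicentral M.
  apply: (adjoined_bicentral M_diff); first by left; exists i.
  exact: adjoined_central S_ext T_ext i.
pose s i : bicenter M := Bicenter (sigma_br i).
have char0 : [pchar R[i]] =i pred0 by exact: pchar_num.
case: r_dec; set r := (X in polarization _ _ _ X) =>
  _ DP gA dA xiE _ _ [u [uA _ rE splitE]] _.
have genP : substitutes (sgen x y M f) f by [].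
set F := cubic h i1 i2 i3 i4 i5 (sgen x y M f a) (sgen x y M f).
have F0 : F != 0 := F_neq0 H_pres T_div f_inj f_br distinct.
have faF : f (polarization D 3 3 r) = val F.
  have E := substitutes_polarization3 H_pres f_br char0 distinct DP genP; exact: E.
have [gE dE] := pbr_gamma_uniq H_pres T_div f_inj f_br char0 distinct DP gA dA xiE.
have faU : e (polarization D 3 3 r) \is a GRing.unit.
  apply: (cext_div S_ext); apply: contra F0 => /eqP fa0; apply/eqP/val_inj.
  by rewrite -faF -[LHS]/(k (e _)) fa0 !rmorph0.
pose g := \sum_(i < 4)
  polarization D 3 2 r ^+ (3 - i) * bracket h (x i0) (y i0) (x a) (y a) ^+ i * u i.
have rE' : e r = (e (polarization D 3 3 r)) ^- 3 * e g := rE.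
(* Clearing the denominator turns the decomposition into an identity in H itself, to which
   substitutions apply. *)
have rE3 : polarization D 3 3 r ^+ 3 * r = g.
  apply: f_inj; rewrite -[LHS]/(k (e _)) -[RHS]/(k (e _)); congr (k _).
  have -> : e (polarization D 3 3 r ^+ 3 * r) = e (polarization D 3 3 r) ^+ 3 * e r.
    by rewrite /e rmorphM rmorphXn.
  by rewrite rE' mulrA divrr ?unitrX // mul1r.
(* The splitting of the polynomial over S is mapped to T and evaluated at a bicentral [z]. *)
have uE (z : bicenter M) : \sum_(i < 4) f (u i) * bval z ^+ (3 - i) =
    val (F * \prod_(i < 3) (z - s i)).
  have mapl n t : (map_poly k (t%:P * 'X^n)).[bval z] = k t * bval z ^+ n.
    by rewrite rmorphM /= map_polyC map_polyXn hornerCM hornerXn.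
  have mapr t : (map_poly k (t%:P * \prod_(i < 3) ('X - (sigma i)%:P))).[bval z] =
      k t * \prod_(i < 3) (bval z - k (sigma i)).
    rewrite rmorphM /= map_polyC hornerCM rmorph_prod -horner_prod_central;
      last exact: bicentralC.
    by congr (_ * horner _ _); apply: eq_bigr => i _;
      rewrite rmorphB /= map_polyX map_polyC.
  have := congr1 (fun p : {poly S} => (map_poly k p).[bval z]) splitE.
  rewrite mapr rmorph_sum horner_sum; under eq_bigr do rewrite mapl.
  move=> E; rewrite rmorphM rmorph_prod; apply: etrans E _; congr (_ * _); first exact: faF.
have cubE := cubic_factors H_pres T_div f_br char0 distinct DP uA rE3 uE _ F0.
pose p i := root_pair h x y f i1 i2 i3 i4 i5 a (s i).
(* The coordinates of the linear factors are recognised as the root pairs at the [sigma i]. *)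
have pE i : sval (p i) = (k (X i), k (Y i)).
  rewrite /X /Y /factor_coord !rmorphB !rmorphM.
  have sE t : bval (- s i) * t = - (k (sigma i) * t).
    by rewrite -[bval (- s i)]/(val _) rmorphN mulNr.
  rewrite /p /root_pair /scomb [sval _]/(pcomb _ _ _) /pcomb !sE -gE -dE.
  by rewrite ![_ + f _]addrC.
have brE i l : bval (zbr h (p i) (sgen x y M f l)) = k (brX i l).
  by rewrite bval_zbr // /pbr pE /brX bracket_morph.
have cub0 i : cubic h i1 i2 i3 i4 i5 (p i) (sgen x y M f) = 0.
  by rewrite /p /root_pair cubE (bigD1 i) //= subrr mul0r mulr0.
(* The indices have the shape that [big_ord_recl] produces. *)
pose o1 : 'I_3 := lift ord0 ord0; pose o2 : 'I_3 := lift ord0 (lift ord0 ord0).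
have cubR z : cubic h i1 i2 i3 i4 i5 (root_pair h x y f i1 i2 i3 i4 i5 a z) (sgen x y M f) =
    - F * ((z - s ord0) * (z - s o1) * (z - s o2)).
  by rewrite /root_pair cubE !big_ord_recl big_ord0 mulr1 mulrA.
have wE i : w i ^+ 2 = bval (zbr h (p i) (sgen x y M f i1) * zbr h (p i) (sgen x y M f i2)
    * zbr h (p i) (sgen x y M f i3) * zbr h (p i) (sgen x y M f i4)).
  rewrite w_root -[RHS]/(val _) !rmorphM.
  by congr (_ * _ * _ * _); rewrite -[RHS]/(bval _) brE.
have ell i := elliptic_root H_pres T_div f_inj f_br char0 distinct cubR
  (dmod_diff M_diff) K1234 (cub0 i) (wE i).
have [eps epsP] := choice ell; have [m mP] := choice epsP.
exists eps; split=> [i|]; first by case: (mP i).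
have mE i : elliptic_differential h d (w i) (k (X i)) (k (Y i)) *~ eps i = m i.
  by have [_ <- _] := mP i; rewrite /dbr -/(p i) pE.
rewrite !big_ord_recl big_ord0 addr0 !mE addrA.
apply: (elliptic_sum H_pres T_div f_inj f_br char0 distinct cubR).
- by case: (mP ord0) => _ _; exact.
- by case: (mP o1) => _ _; exact.
by case: (mP o2) => _ _; exact.
Qed.
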